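(* Let $G=\mathrm{PSL}_2(\mathbf R)$. Let $X$ be a connected Hausdorff $G$-space equipped with a $G$-invariant probability measure $\mu$ of full support, and assume $(X,\mu)$ has the qualitative Sobolev embedding property. Then either $X$ is a point, or $X\cong\Gamma\backslash G$ as $G$-spaces for some cocompact lattice $\Gamma$ in $G$.
   Context: A $G$-space is a topological space $X$ with a $G$-action such that the action map $G\times X\to X$ is continuous. $(X,\mu)$ has the qualitative Sobolev embedding property if there exist $1\le p<q\le\infty$ and a nonnegative continuous function $\varphi\in L^1(G)$ (Haar measure), not identically zero, such that for every $f\in L^p(X,\mu)$ the convolution $\varphi*f(x)=\int_G\varphi(g)f(g^{-1}x)\,dg$ lies in $L^q(X,\mu)$. $\Gamma\backslash G$ carries the action of $G$ by right multiplication. *)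

(* Defs.v *)
From HB Require Import structures.
From mathcomp Require Import all_boot all_order all_algebra.
From mathcomp Require Import all_classical all_reals all_analysis.
Set Implicit Arguments. Unset Strict Implicit. Unset Printing Implicit Defensive.
Import Order.TTheory GRing.Theory Num.Theory.
Import numFieldNormedType.Exports.
Local Open Scope classical_set_scope.
Local Open Scope ring_scope.

Section PSL2.
Variable R : realType.

Definition pm_class (M : 'M[R]_2) : set 'M[R]_2 := [set N | N = M \/ N = - M].

Definition PSL2 : Type :=
  {A : set 'M[R]_2 | exists M : 'M[R]_2, \det M = 1 /\ A = pm_class M}.

HB.instance Definition _ := gen_eqMixin PSL2.
HB.instance Definition _ := gen_choiceMixin PSL2.

Definition psl_of (M : 'M[R]_2) : PSL2 :=
  match pselect (\det M = 1) with
  | left h => exist _ (pm_class M) (ex_intro _ M (conj h erefl))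
  | right _ => exist _ (pm_class 1%:M) (ex_intro _ 1%:M (conj (det1 _ _) erefl))
  end.

Definition psl_rep (A : PSL2) : 'M[R]_2 := projT1 (cid (proj2_sig A)).

Definition psl_one : PSL2 := psl_of 1%:M.
Definition psl_mul (A B : PSL2) : PSL2 := psl_of (psl_rep A *m psl_rep B).
Definition psl_inv (A : PSL2) : PSL2 := psl_of (invmx (psl_rep A)).

(* quotient topology of the subspace SL_2(R) of 'M[R]_2 *)
Definition psl_open (U : set PSL2) : Prop :=
  exists V : set 'M[R]_2, open V /\
    forall M, \det M = 1 -> (V M <-> U (psl_of M)).

Lemma psl_openT : psl_open setT.
Proof. by exists setT; split; [exact: openT|]. Qed.

Lemma psl_openI : setI_closed psl_open.
Proof.
move=> U1 U2 [V1 [oV1 h1]] [V2 [oV2 h2]]; exists (V1 `&` V2); split.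
  exact: openI.
move=> M dM; split.
  by move=> [/(h1 M dM) ? /(h2 M dM) ?].
by move=> [/(h1 M dM) ? /(h2 M dM) ?].
Qed.

Lemma psl_open_bigU (I : Type) (f : I -> set PSL2) :
  (forall i, psl_open (f i)) -> psl_open (\bigcup_i f i).
Proof.
move=> hf; pose V i := projT1 (cid (hf i)).
have hV i : open (V i) /\ forall M, \det M = 1 -> (V i M <-> f i (psl_of M)).
  exact: (projT2 (cid (hf i))).
exists (\bigcup_i V i); split.
  by apply: bigcup_open => i _; case: (hV i).
move=> M dM; split.
  by move=> [i _ /((hV i).2 M dM) ?]; exists i.
by move=> [i _ /((hV i).2 M dM) ?]; exists i.
Qed.

HB.instance Definition _ :=
  isOpenTopological.Build PSL2 psl_openT psl_openI psl_open_bigU.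
HB.instance Definition _ := isPointed.Build PSL2 psl_one.

End PSL2.

Section Gspaces.
Variable R : realType.
Local Notation G := (PSL2 R).

Definition is_Gspace (X : topologicalType) (act : G -> X -> X) : Prop :=
  [/\ forall x, act (psl_one R) x = x,
      forall g h x, act (psl_mul g h) x = act g (act h x)
    & continuous (fun gx : G * X => act gx.1 gx.2)].

Definition Borel (T : ptopologicalType) := g_sigma_algebraType (@open T).

Definition haar_measure (m : {measure set (Borel G) -> \bar R}) : Prop :=
  [/\ (exists A : set (Borel G), measurable A /\ (0 < m A)%E),
      forall (g : G) (A : set (Borel G)), measurable A ->
        m ((fun x => psl_mul g x) @^-1` A) = m A
    & forall K : set G, compact K -> (m K < +oo)%E].

Definition convolution (X : ptopologicalType) (act : G -> X -> X)
  (m : {measure set (Borel G) -> \bar R}) (phi : G -> R) (f : X -> R) (x : X) : R :=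
  fine (\int[m]_(g in [set: Borel G]) ((phi g * f (act (psl_inv g) x))%:E)).

Definition in_Lp (X : ptopologicalType) (mu : {measure set (Borel X) -> \bar R})
  (p : \bar R) (F : X -> R) : Prop :=
  exists h : Borel X -> R, [/\ measurable_fun [set: Borel X] h,
    (Lnorm mu p (EFin \o h) < +oo)%E
    & {ae mu, forall x : Borel X, F x = h x}].

Definition qualitative_Sobolev (X : ptopologicalType) (act : G -> X -> X)
  (mu : {measure set (Borel X) -> \bar R}) : Prop :=
  exists (p : R) (q : \bar R), [/\ 1 <= p, (p%:E < q)%E &
  exists (m : {measure set (Borel G) -> \bar R}) (phi : G -> R),
    [/\ haar_measure m, [/\ continuous phi, (forall g, 0 <= phi g) &
        (exists g, phi g != 0)],
        m.-integrable [set: Borel G] (EFin \o phi) &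
        forall f : Borel X -> R, measurable_fun [set: Borel X] f ->
          (Lnorm mu p%:E (EFin \o f) < +oo)%E ->
          in_Lp mu q (convolution act m phi f)]].

End Gspaces.

Section Homogeneous.
Variable R : realType.
Local Notation G := (PSL2 R).

Definition is_subgroup (Gam : set G) : Prop :=
  [/\ Gam (psl_one R),
      forall a b, Gam a -> Gam b -> Gam (psl_mul a b)
    & forall a, Gam a -> Gam (psl_inv a)].

Definition is_discrete (Gam : set G) : Prop :=
  forall a, Gam a -> exists U : set G, [/\ open U, U a & U `&` Gam = [set a]].

Definition rcoset (Gam : set G) (g : G) : set G := [set psl_mul a g | a in Gam].

Definition cosets (Gam : set G) : Type :=
  {A : set G | exists g, A = rcoset Gam g}.

Definition coset_of (Gam : set G) (g : G) : cosets Gam :=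
  exist _ (rcoset Gam g) (ex_intro _ g erefl).

Definition coset_rep (Gam : set G) (y : cosets Gam) : G :=
  projT1 (cid (proj2_sig y)).

Definition QG (Gam : set G) : Type := cosets Gam.
HB.instance Definition _ (Gam : set G) := gen_eqMixin (QG Gam).
HB.instance Definition _ (Gam : set G) := gen_choiceMixin (QG Gam).

Definition qopen (Gam : set G) (U : set (QG Gam)) : Prop :=
  open ((coset_of Gam : G -> QG Gam) @^-1` U).

Lemma qopenT Gam : qopen (setT : set (QG Gam)).
Proof. by rewrite /qopen preimage_setT; exact: openT. Qed.

Lemma qopenI Gam : setI_closed (@qopen Gam).
Proof. by move=> U V oU oV; rewrite /qopen preimage_setI; exact: openI. Qed.

Lemma qopen_bigU Gam (I : Type) (f : I -> set (QG Gam)) :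
  (forall i, qopen (f i)) -> qopen (\bigcup_i f i).
Proof. by move=> h; rewrite /qopen preimage_bigcup; apply: bigcup_open => i _; exact: h. Qed.

HB.instance Definition _ (Gam : set G) :=
  isOpenTopological.Build (QG Gam) (@qopenT Gam) (@qopenI Gam) (@qopen_bigU Gam).

(* G acts on Gamma \ G by right multiplication, written as a left action:
   g . (Gamma h) = Gamma h g^-1 *)
Definition qact (Gam : set G) (g : G) (y : QG Gam) : QG Gam :=
  coset_of Gam (psl_mul (coset_rep y) (psl_inv g)).

Definition cocompact_lattice (Gam : set G) : Prop :=
  [/\ is_subgroup Gam, is_discrete Gam & compact [set: QG Gam]].

Definition Gspace_iso (X Y : topologicalType) (actX : G -> X -> X)
  (actY : G -> Y -> Y) : Prop :=
  exists (u : X -> Y) (v : Y -> X),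
    [/\ cancel u v, cancel v u, continuous u, continuous v
      & forall g x, u (actX g x) = actY g (u x)].

End Homogeneous.

(* Main.v *)
Require Import Defs.
From HB Require Import structures.
From mathcomp Require Import all_boot all_order all_algebra.
From mathcomp Require Import all_classical all_reals all_analysis.
From mathcomp Require Import measurable_realfun ess_sup_inf.
From mathcomp Require Import ring lra.
Import Order.TTheory GRing.Theory Num.Theory.
Import numFieldNormedType.Exports.
Local Open Scope classical_set_scope.
Local Open Scope ring_scope.
Set Implicit Arguments. Unset Strict Implicit. Unset Printing Implicit Defensive.

(** If the sets [V U], for a fixed small symmetric neighbourhood [V] of [1] and
[U] open, had arbitrarily small measure, a series of multiples of indicators of
sets [V (V U)] would give [f] in [L^p] with [phi * f] not in [L^q]: here [V V] is
covered by finitely many translates of [V], so [mu (V (V U))] is comparable with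
[mu (V U)], and [q > p]. Hence [mu (V U)] is bounded below. As [X] is Hausdorff
and [mu] is finite, only boundedly many translates [K x] of a compact set can be
pairwise disjoint, so [X] is a finite union of compact pieces of orbits; a
minimal such union shows that the orbits are open, and connectedness gives a
single compact orbit.

If a stabilizer is discrete, [X] is its (compact) coset space. Otherwise,
conjugating small elements of the stabilizer by diagonal matrices and passing to
the limit in [X] produces a point fixed by all upper unipotents. By Poincare
recurrence for a diagonal element, all points are then fixed by the upper
unipotents, hence by [G], and [X] is a point. *)

(** * The group PSL2(R) *)

(** The embedding property gives membership in [L^q] without a norm inequality, so its failure at
    all scales has to be gathered in one function. At a single scale, put [b = mu (V U)]: the
    function equal to [b^(-1/p)] on [V (V U)] has bounded [L^p] norm, and its convolution with [phi]
    is at least a constant times [b^(-1/p)] on a translate of [V U]. The [L^q] norm of the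
    convolution is then at least a constant times [b^(1/q - 1/p)], unbounded as [b] tends to 0.

    The limit in [X] rests on one principle: since [X] is compact Hausdorff, the elements of [G]
    that have a fixed point form a closed set. Coming arbitrarily close to a unipotent therefore
    suffices.

    The projective line is a compact orbit with non-discrete stabilizers and a point fixed by all
    upper unipotents. What excludes it is that it carries no invariant probability measure; hence
    recurrence, and not topology alone, in the last step. *)

Section matrices.
Variable R : realType.
Local Notation G := (PSL2 R).
Implicit Types (M N A B : 'M[R]_2) (g h : G).

Lemma ord2_eq (i : 'I_2) : i = 0 \/ i = 1.
Proof.
by case: i => [[|[|//]] ?]; [left|right]; apply: val_inj.
Qed.

Definition mx2 (a b c d : R) : 'M[R]_2 :=
  \matrix_(i < 2, j < 2)
    (if i == 0 then (if j == 0 then a else b) else (if j == 0 then c else d)).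

Lemma mx2_eta M : M = mx2 (M 0 0) (M 0 1) (M 1 0) (M 1 1).
Proof.
apply/matrixP => i j; rewrite !mxE.
by case: (ord2_eq i) => ->; case: (ord2_eq j) => ->.
Qed.

Lemma mx2M a b c d a' b' c' d' : mx2 a b c d *m mx2 a' b' c' d' =
  mx2 (a * a' + b * c') (a * b' + b * d') (c * a' + d * c') (c * b' + d * d').
Proof.
apply/matrixP => i j; rewrite !mxE !big_ord_recl big_ord0 !mxE /=.
by case: (i == 0); case: (j == 0); rewrite addr0.
Qed.

Lemma mx2_1 : 1%:M = mx2 1 0 0 1.
Proof.
apply/matrixP => i j; rewrite !mxE.
by case: (ord2_eq i) => ->; case: (ord2_eq j) => ->.
Qed.

Lemma det_mx2 a b c d : \det (mx2 a b c d) = a * d - b * c.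
Proof.
rewrite (expand_det_row _ 0) !big_ord_recl big_ord0 /cofactor !det_mx11 !mxE /=.
by rewrite !add0n expr0 expr1 /=; ring.
Qed.

Lemma detN2 M : \det (- M) = \det M.
Proof. by rewrite -scaleN1r detZ expr2 mulrNN !mul1r. Qed.


Lemma det_invmx2 M : \det M = 1 -> \det (invmx M) = 1.
Proof. by move=> dM; rewrite det_inv dM invr1. Qed.

Lemma det_mulmx2 M N : \det M = 1 -> \det N = 1 -> \det (M *m N) = 1.
Proof. by move=> dM dN; rewrite det_mulmx dM dN mulr1. Qed.

Lemma unitmx2 M : \det M = 1 -> M \in unitmx.
Proof. by move=> dM; rewrite unitmxE dM unitr1. Qed.

Lemma psl_ofE M (dM : \det M = 1) :
  psl_of M = exist _ (pm_class M) (ex_intro _ M (conj dM erefl)).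
Proof.
rewrite /psl_of; case: pselect => // h.
by congr exist; exact: Prop_irrelevance.
Qed.

Lemma psl_of_eqP M N : \det M = 1 -> \det N = 1 ->
  psl_of M = psl_of N <-> (N = M \/ N = - M).
Proof.
move=> dM dN; rewrite !psl_ofE; split.
  by move=> [] e; have : pm_class M N by rewrite e; left.
move=> h; apply: eq_exist => /=; rewrite /pm_class; apply/seteqP; split => P /=;
  by case: h => ->; rewrite ?opprK => -[->|->]; rewrite ?opprK; auto.
Qed.

Lemma psl_of_opp M : \det M = 1 -> psl_of (- M) = psl_of M.
Proof. by move=> dM; apply/psl_of_eqP; rewrite ?detN2 ?opprK; auto. Qed.

Lemma psl_repP g : \det (psl_rep g) = 1 /\ g = psl_of (psl_rep g).
Proof.
rewrite /psl_rep; case: cid => M /= [dM e]; split => //.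
by rewrite psl_ofE; case: g e => A h /= e; exact: eq_exist.
Qed.

Lemma psl_ofP g : exists2 M, \det M = 1 & g = psl_of M.
Proof. by have [] := psl_repP g; exists (psl_rep g). Qed.

Lemma psl_rep_of M : \det M = 1 ->
  psl_rep (psl_of M) = M \/ psl_rep (psl_of M) = - M.
Proof.
move=> dM; have [d e] := psl_repP (psl_of M).
exact/(psl_of_eqP dM d).
Qed.

Lemma psl_mulE M N : \det M = 1 -> \det N = 1 ->
  psl_mul (psl_of M) (psl_of N) = psl_of (M *m N).
Proof.
move=> dM dN; rewrite /psl_mul.
have dMN := det_mulmx2 dM dN.
case: (psl_rep_of dM) => ->; case: (psl_rep_of dN) => -> //;
  by rewrite ?mulNmx ?mulmxN ?opprK // psl_of_opp.
Qed.

Lemma invmxN2 M : \det M = 1 -> invmx (- M) = - invmx M.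
Proof.
move=> dM; rewrite -[LHS]mulmx1 -(mulmxV (unitmx2 dM)) -[M *m _]opprK -mulNmx.
by rewrite mulmxN mulKmx// unitmx2 ?detN2.
Qed.

Lemma psl_invE M : \det M = 1 -> psl_inv (psl_of M) = psl_of (invmx M).
Proof.
move=> dM; rewrite /psl_inv.
by case: (psl_rep_of dM) => -> //; rewrite invmxN2// psl_of_opp// det_invmx2.
Qed.

Lemma psl_mul3E A B C : \det A = 1 -> \det B = 1 -> \det C = 1 ->
  psl_mul (psl_of A) (psl_mul (psl_of B) (psl_of C)) = psl_of (A *m (B *m C)).
Proof.
by move=> dA dB dC; rewrite [psl_mul (psl_of B) _]psl_mulE// psl_mulE// det_mulmx2.
Qed.

Lemma psl_mulA g h k : psl_mul g (psl_mul h k) = psl_mul (psl_mul g h) k.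
Proof.
case: (psl_ofP g) => M dM ->; case: (psl_ofP h) => N dN ->.
case: (psl_ofP k) => P dP ->.
by rewrite !psl_mulE ?det_mulmx2 // mulmxA.
Qed.

Lemma psl_mul1g g : psl_mul (psl_one R) g = g.
Proof.
by case: (psl_ofP g) => M dM ->; rewrite psl_mulE ?det1// mul1mx.
Qed.

Lemma psl_mulg1 g : psl_mul g (psl_one R) = g.
Proof.
by case: (psl_ofP g) => M dM ->; rewrite psl_mulE ?det1// mulmx1.
Qed.

Lemma psl_mulVg g : psl_mul (psl_inv g) g = psl_one R.
Proof.
case: (psl_ofP g) => M dM ->.
by rewrite psl_invE// psl_mulE ?det_invmx2// mulVmx ?unitmx2.
Qed.

Lemma psl_mulgV g : psl_mul g (psl_inv g) = psl_one R.
Proof.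
case: (psl_ofP g) => M dM ->.
by rewrite psl_invE// psl_mulE ?det_invmx2// mulmxV ?unitmx2.
Qed.

Lemma psl_mulKg g h : psl_mul (psl_inv g) (psl_mul g h) = h.
Proof. by rewrite psl_mulA psl_mulVg psl_mul1g. Qed.

Lemma psl_mulKVg g h : psl_mul g (psl_mul (psl_inv g) h) = h.
Proof. by rewrite psl_mulA psl_mulgV psl_mul1g. Qed.

Lemma psl_invK g : psl_inv (psl_inv g) = g.
Proof. by rewrite -[LHS]psl_mulg1 -(psl_mulVg g) psl_mulKg. Qed.

Lemma psl_invM g h : psl_inv (psl_mul g h) = psl_mul (psl_inv h) (psl_inv g).
Proof.
rewrite -[RHS](psl_mulKg (psl_mul g h)) -psl_mulA psl_mulKVg psl_mulgV.
by rewrite psl_mulg1.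
Qed.

Lemma psl_inv1 : psl_inv (psl_one R) = psl_one R.
Proof. by rewrite -[LHS]psl_mul1g psl_mulgV. Qed.

Definition uu (s : R) : G := psl_of (mx2 1 s 0 1).
Definition ll (s : R) : G := psl_of (mx2 1 0 s 1).
Definition dd (l : R) : G := psl_of (mx2 l 0 0 l^-1).

Lemma det_uu s : \det (mx2 1 s 0 1) = 1 :> R.
Proof. by rewrite det_mx2; ring. Qed.

Lemma det_ll s : \det (mx2 1 0 s 1) = 1 :> R.
Proof. by rewrite det_mx2; ring. Qed.

Lemma det_dd l : l != 0 -> \det (mx2 l 0 0 l^-1) = 1 :> R.
Proof. by move=> l0; rewrite det_mx2 mulfV// mul0r subr0. Qed.

Lemma uuD s t : uu (s + t) = psl_mul (uu s) (uu t).
Proof.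
rewrite psl_mulE ?det_uu// mx2M; congr psl_of.
by rewrite !(mulr0, mul0r, mulr1, mul1r, addr0, add0r) addrC.
Qed.

Lemma llD s t : ll (s + t) = psl_mul (ll s) (ll t).
Proof.
rewrite psl_mulE ?det_ll// mx2M; congr psl_of.
by rewrite !(mulr0, mul0r, mulr1, mul1r, addr0, add0r).
Qed.

Lemma uu0 : uu 0 = psl_one R.
Proof. by rewrite /uu /psl_one mx2_1. Qed.

Lemma ll0 : ll 0 = psl_one R.
Proof. by rewrite /ll /psl_one mx2_1. Qed.

Lemma uuN s : uu (- s) = psl_inv (uu s).
Proof.
by rewrite -[RHS]psl_mulg1 -uu0 -(subrr s) uuD psl_mulKg.
Qed.

Lemma llN s : ll (- s) = psl_inv (ll s).
Proof.
by rewrite -[RHS]psl_mulg1 -ll0 -(subrr s) llD psl_mulKg.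
Qed.

Lemma dd_ll l s : l != 0 ->
  psl_mul (dd l) (ll s) = psl_mul (ll (s / l ^+ 2)) (dd l).
Proof.
move=> l0; rewrite !psl_mulE ?det_ll ?det_dd// !mx2M; congr psl_of.
by congr mx2; field.
Qed.

Lemma dd_uu l s : l != 0 ->
  psl_mul (uu s) (dd l) = psl_mul (dd l) (uu (s / l ^+ 2)).
Proof.
move=> l0; rewrite !psl_mulE ?det_uu ?det_dd// !mx2M; congr psl_of.
by congr mx2; field.
Qed.

Lemma dd1 : dd 1 = psl_one R.
Proof. by rewrite /dd invr1 /psl_one mx2_1. Qed.

Lemma ddX l n : l != 0 -> dd (l ^+ n) = iter n (psl_mul (dd l)) (psl_one R).
Proof.
move=> l0; elim: n => [|n IH].
  by rewrite expr0 dd1.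
rewrite iterS -IH /dd psl_mulE ?det_dd ?expf_neq0// mx2M; congr psl_of.
by rewrite exprS invfM !(mulr0, mul0r, mulr1, mul1r, addr0, add0r).
Qed.

(** This cell serves as a chart around the identity, and it isolates the lower unipotent factor,
    which conjugation by [dd l] contracts for [l > 1]. *)
Lemma big_cell M : \det M = 1 -> M 0 0 != 0 -> psl_of M =
  psl_mul (ll (M 1 0 / M 0 0)) (psl_mul (dd (M 0 0)) (uu (M 0 1 / M 0 0))).
Proof.
move=> dM a0; rewrite psl_mul3E ?det_ll ?det_uu ?det_dd//.
rewrite [in LHS](mx2_eta M) !mx2M; congr psl_of.
have dE : M 0 0 * M 1 1 - M 0 1 * M 1 0 = 1 by rewrite -det_mx2 -mx2_eta.
have -> : M 1 1 = (1 + M 0 1 * M 1 0) / M 0 0.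
  by rewrite -dE; field.
by congr mx2; field.
Qed.

Lemma uluE M : \det M = 1 -> M 1 0 != 0 -> psl_of M =
  psl_mul (uu ((M 0 0 - 1) / M 1 0))
    (psl_mul (ll (M 1 0)) (uu ((M 1 1 - 1) / M 1 0))).
Proof.
move=> dM a0; rewrite psl_mul3E ?det_ll ?det_uu//.
rewrite [in LHS](mx2_eta M) !mx2M; congr psl_of.
have dE : M 0 0 * M 1 1 - M 0 1 * M 1 0 = 1 by rewrite -det_mx2 -mx2_eta.
have -> : M 0 1 = (M 0 0 * M 1 1 - 1) / M 1 0.
  by rewrite -dE; field.
by congr mx2; field.
Qed.

(** If the lower left entry vanishes, the lower right one does not, and right multiplication by
    [ll 1] copies it to the lower left; the fourth factor undoes this. Hence boxes of four
    parameters exhaust [G] by compact sets, and an action in which both unipotent groups act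
    trivially is trivial. *)
Lemma ulul g : exists s t r v,
  g = psl_mul (uu s) (psl_mul (ll t) (psl_mul (uu r) (ll v))).
Proof.
case: (psl_ofP g) => M dM ->.
have [c0|c0] := eqVneq (M 1 0) 0; last first.
  exists ((M 0 0 - 1) / M 1 0), (M 1 0), ((M 1 1 - 1) / M 1 0), 0.
  by rewrite ll0 psl_mulg1 uluE.
have dE : M 0 0 * M 1 1 - M 0 1 * M 1 0 = 1 by rewrite -det_mx2 -mx2_eta.
have d0 : M 1 1 != 0.
  apply/eqP => d0; move: dE; rewrite c0 d0 !mulr0 subrr => /esym/eqP.
  by rewrite oner_eq0.
pose N := M *m mx2 1 0 1 1.
have dN : \det N = 1 by rewrite det_mulmx2 ?det_ll.
have NE : N 1 0 = M 1 1.
  by rewrite /N {1}(mx2_eta M) mx2M mxE /= c0 mul0r add0r mulr1.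
have -> : psl_of M = psl_mul (psl_of N) (ll (-1)).
  rewrite -[psl_of N]psl_mulE ?det_ll// -/(ll 1) -psl_mulA -llD subrr ll0.
  by rewrite psl_mulg1.
exists ((N 0 0 - 1) / N 1 0), (N 1 0), ((N 1 1 - 1) / N 1 0), (-1).
by rewrite uluE ?NE// !psl_mulA.
Qed.

End matrices.

(** * The topology of PSL2(R) and continuity of its operations *)

Section psl_topology.
Variable R : realType.
Local Notation G := (PSL2 R).
Implicit Types (M N A B : 'M[R]_2) (g h : G).

Lemma cvg_mx2 (T : Type) (F : set_system T) {FF : Filter F}
    (f : T -> 'M[R]_2) M :
  (forall i j, (f t i j) @[t --> F] --> M i j) -> f @ F --> M.
Proof.
move=> h; apply/cvg_ballP => e e0.
have h' : \forall t \near F, forall i j, ball (M i j) e (f t i j).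
  apply: filter_forall => i; apply: filter_forall => j.
  by move/cvg_ballP: (h i j); apply.
by apply: filterS h' => t ht; split.
Qed.

Lemma cvg_to_mx2 (T : Type) (F : set_system T) {FF : Filter F}
    (a b c d : T -> R) (a0 b0 c0 d0 : R) :
  a @ F --> a0 -> b @ F --> b0 -> c @ F --> c0 -> d @ F --> d0 ->
  (mx2 (a t) (b t) (c t) (d t)) @[t --> F] --> mx2 a0 b0 c0 d0.
Proof.
move=> ha hb hc hd; apply: cvg_mx2 => i j; rewrite mxE.
have -> : (fun t => mx2 (a t) (b t) (c t) (d t) i j) = (fun t =>
   if i == 0 then (if j == 0 then a t else b t)
             else (if j == 0 then c t else d t)).
  by apply/funext => t; rewrite mxE.
by case: (i == 0); case: (j == 0).
Qed.

Lemma cvg_coord M i j : (fun N : 'M[R]_2 => N i j) @ nbhs M --> M i j.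
Proof. exact: coord_continuous. Qed.

Lemma cvg_mulmx2 (T : Type) (F : set_system T) {FF : Filter F}
    (f g : T -> 'M[R]_2) M N :
  f @ F --> M -> g @ F --> N -> (f t *m g t) @[t --> F] --> M *m N.
Proof.
move=> fM gN.
have fc i j : (f t i j) @[t --> F] --> M i j.
  exact: (cvg_comp _ _ fM (@cvg_coord M i j)).
have gc i j : (g t i j) @[t --> F] --> N i j.
  exact: (cvg_comp _ _ gN (@cvg_coord N i j)).
rewrite (mx2_eta M) (mx2_eta N) mx2M.
under eq_fun do rewrite (mx2_eta (f _)) (mx2_eta (g _)) mx2M.
by apply: cvg_to_mx2; apply: cvgD; apply: cvgM.
Qed.

Lemma invmx2E M : \det M = 1 -> invmx M = mx2 (M 1 1) (- M 0 1) (- M 1 0) (M 0 0).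
Proof.
move=> dM; have dE : M 0 0 * M 1 1 - M 0 1 * M 1 0 = 1.
  by rewrite -det_mx2 -mx2_eta.
rewrite -[RHS](mulKmx (unitmx2 dM)) {3}(mx2_eta M) mx2M.
rewrite [X in invmx M *m X](_ : _ = 1%:M) ?mulmx1// mx2_1.
by rewrite -dE; congr mx2; ring.
Qed.

Lemma nbhs_openP (T : topologicalType) (x : T) (A : set T) :
  nbhs x A <-> exists2 B : set T, open_nbhs x B & B `<=` A.
Proof. by rewrite nbhsE. Qed.

Lemma nbhs_psl M (U : set G) : \det M = 1 ->
  nbhs (psl_of M) U <-> \forall N \near M, \det N = 1 -> U (psl_of N).
Proof.
move=> dM; split.
  move=> /nbhs_openP[Q [[V [oV hV]] OM] OU].
  have : nbhs M V by apply: open_nbhs_nbhs; split => //; exact/hV.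
  by apply: filterS => N VN dN; apply: OU; apply/hV.
move=> /nbhs_openP[V [oV VM] VU].
(* [psl_rep] may return a matrix of either sign, so the open set is first made invariant under
   negation. *)
pose W := V `|` [set N | V (- N)].
have oW : open W.
  by apply: openU => //; apply: open_comp => // N _; exact: opp_continuous.
apply/nbhs_openP; exists [set g | W (psl_rep g)]; last first.
  move=> g /= Wg; have [dg ->] := psl_repP g.
  case: Wg => /= [/VU|/VU]; first exact.
  by rewrite detN2 psl_of_opp//; exact.
split.
  exists W; split => // N dN.
  by case: (psl_rep_of dN) => /= ->; rewrite /W /= ?opprK; tauto.
by case: (psl_rep_of dM) => /= ->; rewrite /W /= ?opprK; tauto.
Qed.

Lemma cvg_psl_of (T : Type) (F : set_system T) {FF : Filter F}
    (f : T -> 'M[R]_2) M : \det M = 1 -> (forall t, \det (f t) = 1) ->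
  f @ F --> M -> (psl_of (f t)) @[t --> F] --> psl_of M.
Proof.
move=> dM df fM U /(nbhs_psl _ dM)/fM; rewrite !near_simpl.
by apply: filterS => t; apply.
Qed.

Lemma psl_mul_continuous : continuous (fun gh : G * G => psl_mul gh.1 gh.2).
Proof.
move=> [g h]; case: (psl_ofP g) => A dA ->; case: (psl_ofP h) => B dB ->.
rewrite /continuous_at /= psl_mulE// => U /(nbhs_psl _ (det_mulmx2 dA dB)) nU.
have := @cvg_mulmx2 _ (nbhs (A, B)) _ fst snd A B cvg_fst cvg_snd _ nU.
move=> [[V W] /= [VA WB] VW].
exists ([set psl_of N | N in V `&` [set N | \det N = 1]],
        [set psl_of N | N in W `&` [set N | \det N = 1]]).
  by split => /=; apply/nbhs_psl => //;
    [apply: filterS VA|apply: filterS WB] => N ? ?; exists N.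
move=> [_ _] [/= [N [VN dN] <-] [P [WP dP] <-]].
rewrite psl_mulE//; apply: (VW (N, P)) => //=.
by rewrite det_mulmx2.
Qed.

Lemma psl_inv_continuous : continuous (@psl_inv R).
Proof.
move=> g; case: (psl_ofP g) => A dA ->; rewrite /continuous_at psl_invE// => U.
move/(nbhs_psl _ (det_invmx2 dA)) => nU; apply/nbhs_psl => //.
(* The adjugate agrees with the inverse on determinant 1 and is visibly continuous on all
   matrices. *)
pose adj N : 'M[R]_2 := mx2 (N 1 1) (- N 0 1) (- N 1 0) (N 0 0).
have adjA : adj N @[N --> A] --> adj A.
  apply: (@cvg_to_mx2 _ (nbhs A)); [exact: cvg_coord| | |exact: cvg_coord].
    exact: (cvgN (@cvg_coord A _ _)).
  exact: (cvgN (@cvg_coord A _ _)).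
have : \forall N \near A, \det (adj N) = 1 -> U (psl_of (adj N)).
  by move: nU; rewrite invmx2E// => /adjA.
apply: filterS => N hN dN; rewrite /= psl_invE// invmx2E//; apply: hN.
by rewrite -[adj N]invmx2E// det_invmx2.
Qed.

Lemma cvg_psl_mul (T : Type) (F : set_system T) {FF : Filter F}
    (f f' : T -> G) g g' :
  f @ F --> g -> f' @ F --> g' -> (psl_mul (f t) (f' t)) @[t --> F] --> psl_mul g g'.
Proof.
move=> fg fg'; have := cvg_comp2 fg fg' (@psl_mul_continuous (g, g')).
exact.
Qed.

Lemma psl_mull_continuous g : continuous (psl_mul g).
Proof. by move=> h; apply: (@cvg_psl_mul _ (nbhs h) _ (fun=> g) id); [exact: (cvg_cst g)|exact: cvg_id]. Qed.

Lemma nbhs_psl_mull g h (U : set G) :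
  nbhs (psl_mul g h) (psl_mul g @` U) <-> nbhs h U.
Proof.
split=> [/psl_mull_continuous nh|nU].
  have nh' : nbhs h (psl_mul g @^-1` (psl_mul g @` U)) := nh.
  apply: filterS nh' => k [k' Uk'].
  by move=> /(congr1 (psl_mul (psl_inv g))); rewrite !psl_mulKg => <-.
have : nbhs (psl_mul (psl_inv g) (psl_mul g h)) U by rewrite psl_mulKg.
move=> /psl_mull_continuous nh.
have nh' : nbhs (psl_mul g h) (psl_mul (psl_inv g) @^-1` U) := nh.
apply: filterS nh' => k Uk.
by exists (psl_mul (psl_inv g) k) => //; rewrite psl_mulKVg.
Qed.

Lemma uu_continuous : continuous (@uu R).
Proof.
move=> s; apply: (@cvg_psl_of _ (nbhs s)) => [|t|]; rewrite ?det_uu//.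
by apply: (@cvg_to_mx2 _ (nbhs s)); [exact: cvg_cst|exact: cvg_id|exact: cvg_cst|exact: cvg_cst].
Qed.

Lemma ll_continuous : continuous (@ll R).
Proof.
move=> s; apply: (@cvg_psl_of _ (nbhs s)) => [|t|]; rewrite ?det_ll//.
by apply: (@cvg_to_mx2 _ (nbhs s)); [exact: cvg_cst|exact: cvg_cst|exact: cvg_id|exact: cvg_cst].
Qed.

Lemma dd_exp_continuous : continuous (fun t : R => dd (expR t)).
Proof.
move=> s; apply: (@cvg_psl_of _ (nbhs s)) => [|t|]; rewrite ?det_dd ?gt_eqF ?expR_gt0//.
apply: (@cvg_to_mx2 _ (nbhs s)); [exact: continuous_expR|exact: cvg_cst|exact: cvg_cst|].
by apply: cvgV; [rewrite gt_eqF ?expR_gt0//|exact: continuous_expR].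
Qed.

End psl_topology.

(** * Local compactness and sigma-compactness of PSL2(R) *)

Section psl_compactness.
Variable R : realType.
Local Notation G := (PSL2 R).
Implicit Types (g h : G).

Lemma nbhs_psl_translate g (V : set G) :
  nbhs (psl_one R) V -> nbhs g [set h | V (psl_mul (psl_inv g) h)].
Proof.
rewrite -(psl_mulVg g) => /psl_mull_continuous nh.
exact: nh.
Qed.

Lemma continuous_psl_mul2 (T : topologicalType) (f f' : T -> G) :
  continuous f -> continuous f' -> continuous (fun t => psl_mul (f t) (f' t)).
Proof.
by move=> cf cf' t; apply: (@cvg_psl_mul _ _ (nbhs t)); [exact: cf|exact: cf'].
Qed.

Lemma compact_psl_mul (K L : set G) : compact K -> compact L ->
  compact [set psl_mul g h | g in K & h in L].
Proof.
move=> cK cL.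
have -> : [set psl_mul g h | g in K & h in L] =
    (fun gh : G * G => psl_mul gh.1 gh.2) @` (K `*` L).
  apply/seteqP; split => [_ [g Kg [h Lh <-]]|_ [[g h] [/= Kg Lh] <-]].
    by exists (g, h).
  by exists g => //; exists h.
apply: continuous_compact; last exact: compact_setX.
by apply: continuous_subspaceT; exact: psl_mul_continuous.
Qed.

Lemma compact_psl_inv (K : set G) : compact K -> compact (@psl_inv R @` K).
Proof.
move=> cK; apply: continuous_compact => //.
by apply: continuous_subspaceT; exact: psl_inv_continuous.
Qed.

(** Small cubes have compact images under the chart [box]; these are neighbourhoods because
    [big_cell] recovers the three parameters continuously from the entries of a matrix near the
    identity. The exponential makes the chart continuous on all of [R^3]. *)
Lemma psl_compact_nbhs1 (U : set G) : nbhs (psl_one R) U ->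
  exists C : set G, [/\ compact C, nbhs (psl_one R) C & C `<=` U].
Proof.
move=> nU.
pose box (p : R * R * R) : G :=
  psl_mul (ll p.1.1) (psl_mul (dd (expR p.1.2)) (uu p.2)).
have cbox : continuous box.
  apply: continuous_psl_mul2; last apply: continuous_psl_mul2.
  - move=> p; apply: (@continuous_comp _ _ _ (fun p : R * R * R => p.1.1) (@ll R)).
      by apply: continuous_comp; exact: cvg_fst.
    exact: ll_continuous.
  - move=> p; apply: (@continuous_comp _ _ _ (fun p : R * R * R => p.1.2)
      (fun t => dd (expR t))).
      by apply: continuous_comp; [exact: cvg_fst|exact: cvg_snd].
    exact: dd_exp_continuous.
  - move=> p; apply: (@continuous_comp _ _ _ (fun p : R * R * R => p.2) (@uu R)).
      exact: cvg_snd.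
    exact: uu_continuous.
have box0 : box (0, 0, 0) = psl_one R.
  by rewrite /box /= ll0 uu0 expR0 dd1 !psl_mul1g.
have : nbhs ((0, 0, 0) : R * R * R) (box @^-1` U).
  by apply: cbox; rewrite box0.
move=> /nbhs_ballP[e /= e0 eU].
pose I : set R := `[- (e / 2), e / 2]%classic.
have e20 : 0 < e / 2 by rewrite divr_gt0.
have IE x : I x <-> `|x| <= e / 2.
  by rewrite /I /= in_itv /= ler_norml.
have Ie x : I x -> `|x| < e.
  by move=> /IE /le_lt_trans; apply; rewrite gtr_pMr// invf_lt1// ltr1n.
exists (box @` (I `*` I `*` I)); split.
- apply: continuous_compact; first exact: continuous_subspaceT.
  by do 2 ?apply: compact_setX; exact: segment_compact.
- rewrite /psl_one; apply/nbhs_psl; first exact: det1.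
  have c00 := @cvg_coord R (1%:M : 'M[R]_2) 0 0; have c01 := @cvg_coord R (1%:M : 'M[R]_2) 0 1.
  have c10 := @cvg_coord R (1%:M : 'M[R]_2) 1 0.
  rewrite !mxE /= in c00 c01 c10.
  have h10 := cvgM c10 (cvgV (oner_neq0 _) c00). 
  have h01 := cvgM c01 (cvgV (oner_neq0 _) c00).
  have hln := cvg_comp _ _ c00 (continuous_ln ltr01).
  rewrite !mul0r in h10 h01; rewrite ln1 in hln.
  have n00 := c00 _ (lt_nbhsr ltr01).
  have near0 (f : 'M[R]_2 -> R) : f @ nbhs (1%:M : 'M[R]_2) --> 0 ->
      \forall N \near nbhs (1%:M : 'M[R]_2), I (f N).
    move=> /cvgr0Pnorm_le /(_ _ e20); apply: filterS => N.
    by move/IE.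
  have {}h10 := near0 _ (h10 _ _); have {}h01 := near0 _ (h01 _ _).
  have {}hln := near0 _ hln.
  near=> N => dN; have N0 : 0 < N 0 0 by near: N; exact: n00.
  rewrite big_cell ?gt_eqF//.
  exists (N 1 0 / N 0 0, ln (N 0 0), N 0 1 / N 0 0).
    split; [split|].
    - by near: N; exact: h10.
    - by near: N; exact: hln.
    - by near: N; exact: h01.
  by rewrite /box /= lnK.
- move=> _ [[[x y] z] [[/= Ix Iy] Iz] <-]; apply: eU.
  by do 2 ?split => /=; rewrite /ball /= sub0r normrN; exact: Ie.
Unshelve. all: by end_near.
Qed.

Lemma psl_compact_nbhs g (U : set G) : nbhs g U ->
  exists C : set G, [/\ compact C, nbhs g C & C `<=` U].
Proof.
move=> nU.
have : nbhs (psl_one R) (psl_mul g @^-1` U).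
  by apply: psl_mull_continuous; rewrite psl_mulg1.
move=> /psl_compact_nbhs1[C [cC nC CU]].
exists (psl_mul g @` C); split.
- apply: continuous_compact => //; apply: continuous_subspaceT.
  exact: psl_mull_continuous.
- by rewrite -[X in nbhs X](psl_mulg1 g); apply/nbhs_psl_mull.
- by move=> _ [h Ch <-]; exact: CU.
Qed.

Lemma psl_finite_cover (K V : set G) : compact K -> nbhs (psl_one R) V ->
  exists s : seq G, forall h, K h -> exists2 g, g \in s & V (psl_mul (psl_inv g) h).
Proof.
rewrite compact_cover => cK nV.
have [|h Kh|D _ KD] := cK G K (fun g => [set h | V (psl_mul (psl_inv g) h)]^°).
- by move=> g _; exact: open_interior.
- by exists h => //; exact: nbhs_psl_translate.
- exists (finmap.enum_fset D) => h /KD[g Dg] /interior_subset Vh.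
  by exists g.
Qed.

Lemma psl_sigma_compact : exists K : nat -> set G,
  (forall k, compact (K k)) /\ (forall g, exists k, K k g).
Proof.
pose I (k : nat) : set R := `[- k%:R, k%:R]%classic.
pose ul k := [set psl_mul g h | g in (@uu R @` I k) & h in (@ll R @` I k)].
exists (fun k => [set psl_mul g h | g in ul k & h in ul k]); split.
  move=> k; have cu : compact (ul k).
    apply: compact_psl_mul; apply: continuous_compact;
      try exact: segment_compact; apply: continuous_subspaceT.
      exact: uu_continuous.
    exact: ll_continuous.
  exact: compact_psl_mul.
move=> g; have [s [t [r [v ->]]]] := ulul g.
pose m := Num.max (Num.max `|s| `|t|) (Num.max `|r| `|v|).
have : m <= (Num.truncn m).+1%:R.
  by apply: ltW; rewrite truncnS_gt.
move: (Num.truncn m).+1 => k; rewrite !ge_max => /andP[/andP[hs ht] /andP[hr hv]].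
exists k; rewrite psl_mulA -/(psl_mul _ _).
exists (psl_mul (uu s) (ll t)); last exists (psl_mul (uu r) (ll v)) => //.
  exists (uu s); first by exists s => //; rewrite /I /= in_itv/= -ler_norml.
  by exists (ll t) => //; exists t => //; rewrite /I /= in_itv/= -ler_norml.
exists (uu r); first by exists r => //; rewrite /I /= in_itv/= -ler_norml.
by exists (ll v) => //; exists v => //; rewrite /I /= in_itv/= -ler_norml.
Qed.

Lemma psl_countable_cover (V : set G) : nbhs (psl_one R) V ->
  exists g : nat -> G, forall h, exists i, V (psl_mul (psl_inv (g i)) h).
Proof.
move=> nV; have [K [cK KG]] := psl_sigma_compact.
have /choice[s sP] := fun k => psl_finite_cover (cK k) nV.
exists (fun n => if @unpickle (nat * nat)%type n is Some p
  then nth (psl_one R) (s p.1) p.2 else psl_one R) => h.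
have [k Kh] := KG h; have [g gs Vg] := sP k h Kh.
exists (pickle (k, index g (s k))); rewrite pickleK /=.
by rewrite nth_index.
Qed.

End psl_compactness.

(** * Orbits in Hausdorff G-spaces *)

Section Gspace_topology.
Variables (R : realType) (X : topologicalType).
Local Notation G := (PSL2 R).
Variable act : G -> X -> X.
Hypothesis actP : is_Gspace act.
Implicit Types (g h : G) (x y : X).

Lemma act1 x : act (psl_one R) x = x.
Proof. by case: actP. Qed.

Lemma actM g h x : act (psl_mul g h) x = act g (act h x).
Proof. by case: actP. Qed.

Lemma actK g x : act (psl_inv g) (act g x) = x.
Proof. by rewrite -actM psl_mulVg act1. Qed.

Lemma actKV g x : act g (act (psl_inv g) x) = x.
Proof. by rewrite -actM psl_mulgV act1. Qed.

Lemma cvg_act (T : Type) (F : set_system T) {FF : Filter F}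
    (f : T -> G) (k : T -> X) g x :
  f @ F --> g -> k @ F --> x -> (act (f t) (k t)) @[t --> F] --> act g x.
Proof.
move=> fg kx; case: actP => _ _ ca.
exact: (cvg_comp2 fg kx (ca (g, x))).
Qed.

Lemma act_continuous g : continuous (act g).
Proof.
by move=> x; apply: (@cvg_act _ (nbhs x) _ (fun=> g) id); [exact: (cvg_cst g)|exact: cvg_id].
Qed.

Lemma act_orbit_continuous x : continuous (act^~ x).
Proof.
by move=> g; apply: (@cvg_act _ (nbhs g) _ id (fun=> x)); [exact: cvg_id|exact: (cvg_cst x)].
Qed.

Lemma open_act g (U : set X) : open U -> open (act g @` U).
Proof.
move=> oU; have -> : act g @` U = act (psl_inv g) @^-1` U.
  apply/seteqP; split => [_ [x Ux <-]|x Ux] /=; first by rewrite actK.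
  by exists (act (psl_inv g) x) => //; rewrite actKV.
by apply: open_comp => // x _; exact: act_continuous.
Qed.

Definition saturate (V : set G) (U : set X) : set X :=
  [set act g x | g in V & x in U].

Lemma open_saturate (V : set G) (U : set X) : open U -> open (saturate V U).
Proof.
move=> oU; have -> : saturate V U = \bigcup_(g in V) act g @` U.
  apply/seteqP; split => [_ [g Vg [x Ux <-]]|_ [g Vg [x Ux <-]]].
    by exists g => //; exists x.
  by exists g => //; exists x.
by apply: bigcup_open => g _; exact: open_act.
Qed.

Lemma compact_orbit (K : set G) x : compact K -> compact (act^~ x @` K).
Proof.
move=> cK; apply: continuous_compact => //.
by apply: continuous_subspaceT; exact: act_orbit_continuous.
Qed.

Hypothesis hX : hausdorff_space X.

(** Apart from closedness of compact sets, the Hausdorff property enters only in this form: it makes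
    [not fixed] and [not in the same piece of orbit] open conditions. *)
Lemma cvg_neq (T : Type) (F : set_system T) {FF : Filter F}
    (f k : T -> X) x y :
  f @ F --> x -> k @ F --> y -> x <> y -> \forall t \near F, f t <> k t.
Proof.
move=> fx ky /eqP xy.
have := hX; rewrite open_hausdorff => /(_ x y xy)[[A B] /= [xA yB] [oA oB AB]].
have /fx fA : nbhs x A by apply: open_nbhs_nbhs; split => //; rewrite inE in xA.
have /ky kB : nbhs y B by apply: open_nbhs_nbhs; split => //; rewrite inE in yB.
near=> t => ftkt.
have : (A `&` B) (f t).
  by split; [near: t; exact: fA|rewrite ftkt; near: t; exact: kB].
by rewrite (eqP AB).
Unshelve. all: by end_near.
Qed.

(** A tube argument: the inequality persists near each pair [(g, h)] and near [(x, y)], and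
    compactness of the set of pairs yields one neighbourhood of [(x, y)] for all of them. *)
Lemma near_disjoint_orbits (K : set G) x y : compact K ->
  (forall g h, K g -> K h -> act g x <> act h y) ->
  \forall a \near x & b \near y, forall g h, K g -> K h -> act g a <> act h b.
Proof.
move=> cK Kxy.
have /compact_near_coveringP cKK : compact (K `*` K) by exact: compact_setX.
have := cKK _ (nbhs (x, y)) (fun ab gh => act gh.1 ab.1 <> act gh.2 ab.2) _.
case => [[g h] [/= Kg Kh]|[A B] /= [xA yB] AB].
  apply: (@cvg_neq _ (filter_prod (nbhs (g, h)) (nbhs (x, y))) _
     (fun p => act p.1.1 p.2.1) (fun p => act p.1.2 p.2.2) (act g x) (act h y)).
  - apply: cvg_act.
      exact: (cvg_comp _ _ cvg_fst (@cvg_fst _ _ (nbhs g) (nbhs h) _)).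
    exact: (cvg_comp _ _ cvg_snd (@cvg_fst _ _ (nbhs x) (nbhs y) _)).
  - apply: cvg_act.
      exact: (cvg_comp _ _ cvg_fst (@cvg_snd _ _ (nbhs g) (nbhs h) _)).
    exact: (cvg_comp _ _ cvg_snd (@cvg_snd _ _ (nbhs x) (nbhs y) _)).
  - exact: Kxy.
exists (A, B) => // -[a b] [/= Aa Bb] g h Kg Kh.
exact: (AB (a, b) _ (g, h)).
Qed.

Lemma transitive_of_finite_cover (L : set G) (s : seq X) (x0 : X) :
  connected [set: X] -> compact L ->
  (forall x, exists2 y, y \in s & exists2 g, L g & x = act g y) ->
  exists2 K : set G, compact K & forall x, exists2 g, K g & x = act g x0.
Proof.
move=> conX cL sP.
pose cov (t : seq X) := forall x, exists2 y, y \in t & exists2 g, L g & x = act g y.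
have exn : exists n, `[< exists2 t, cov t & size t = n >].
  by exists (size s); apply/asboolP; exists s.
case: (ex_minnP exn) => n /asboolP[t tP szt] nmin.
pose orb y := [set act g y | g in [set: G]].
have orb_open y : y \in t -> open (orb y).
  move=> yt.
  have /existsNP[x nx] : ~ cov (rem y t).
    move=> cr.
    have := nmin (size (rem y t)) (asboolT (ex_intro2 _ _ (rem y t) cr erefl)).
    rewrite size_rem// szt; case: (n) szt => [/size0nil t0|k _]; first by rewrite t0 in yt.
    by rewrite ltnn.
  (* [W] is nonempty by minimality of the cover, open because only finitely many compact sets are
     removed, and contained in [L y]. Its translates fill out neighbourhoods of all points of the
     orbit of [y]. *)
  pose W := ~` \bigcup_(z in [set` rem y t]) (act^~ z @` L).
  have oW : open W.
    apply: closed_openC; rewrite bigcup_seq; apply: closed_bigsetU => z _.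
    by apply: compact_closed => //; exact: compact_orbit.
  have Wx : W x.
    by move=> [z /= zr [g Lg gx]]; apply: nx; exists z => //; exists g.
  have Wy w : W w -> exists2 g, L g & w = act g y.
    move=> Ww; have [z zt [g Lg wE]] := tP w.
    have [zy|zy] := eqVneq z y; first by exists g => //; rewrite -zy.
    exfalso; apply: Ww; exists z => /=; last by exists g.
    by move: zt; rewrite (perm_mem (perm_to_rem yt)) inE (negbTE zy).
  rewrite openE => _ [g _ <-]; have [l _ xE] := Wy x Wx.
  pose h := psl_mul g (psl_inv l).
  have hx : act h x = act g y by rewrite xE /h actM actK.
  apply/nbhs_openP; exists (act h @` W).
    by split; [exact: open_act|exists x].
  move=> _ [w Ww <-]; have [k _ ->] := Wy w Ww.
  by exists (psl_mul h k) => //; rewrite actM.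
have orb_eq y z g : z = act g y -> orb y = orb z.
  move=> ->; apply/seteqP; split => _ [k _ <-].
    by exists (psl_mul k (psl_inv g)) => //; rewrite actM actK.
  by exists (psl_mul k g) => //; rewrite actM.
have {}orb_open y : open (orb y).
  by have [z zt [g _ /orb_eq <-]] := tP y; exact: orb_open.
have orbT : orb x0 = [set: X].
  apply: conX; first by exists x0, (psl_one R) => //; rewrite act1.
    by exists (orb x0) => //; rewrite setTI.
  exists (orb x0); last by rewrite setTI.
  rewrite -[orb x0]setCK; apply: open_closedC.
  have -> : ~` orb x0 = \bigcup_(y in ~` orb x0) orb y.
    apply/seteqP; split => [y ny|y [z nz [g _ gz]] [h _ hx]].
      by exists y => //; exists (psl_one R) => //; rewrite act1.
    apply: nz; exists (psl_mul (psl_inv g) h) => //.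
    by rewrite actM hx -gz actK.
  by apply: bigcup_open => y _; exact: orb_open.
(* The pieces of the cover start at the points of [s]; since [f y] carries [x0] to [y], the sets
   [L (f y)] produce the same pieces from the single point [x0]. *)
have /choice[f fP] x : exists g, x = act g x0.
  have : orb x0 x by rewrite orbT.
  by move=> [g _ <-]; exists g.
exists (\big[setU/set0]_(y <- s) [set psl_mul g h | g in L & h in [set f y]]).
  apply: bigsetU_compact => y _; apply: compact_psl_mul => //.
  exact: compact_set1.
move=> x; have [y ys [g Lg xE]] := sP x.
exists (psl_mul g (f y)); last by rewrite actM -fP.
rewrite -bigcup_seq; exists y => //=.
by exists g => //; exists (f y).
Qed.

End Gspace_topology.

(** * The Sobolev property bounds measures of thickened open sets *)

Section measure_preliminaries.
Context d (T : measurableType d) (R : realType).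
Variable mu : {measure set T -> \bar R}.
Local Open Scope ereal_scope.

(** The values are extended reals because the series may diverge at some points; finiteness almost
    everywhere is later deduced from integrals. *)
Definition wsum (w : nat -> R) (A : nat -> set T) (x : T) : \bar R :=
  \sum_(0 <= n <oo) (w n)%:E * (\1_(A n) x)%:E.

Lemma wsum_term_ge0 (w : nat -> R) (A : nat -> set T) n x :
  (forall n, (0 <= w n)%R) -> 0 <= (w n)%:E * (\1_(A n) x)%:E.
Proof. by move=> w0; rewrite mule_ge0// lee_fin. Qed.

Lemma wsum_ge0 (w : nat -> R) (A : nat -> set T) x :
  (forall n, (0 <= w n)%R) -> 0 <= wsum w A x.
Proof. by move=> w0; apply: nneseries_ge0 => n _ _; exact: wsum_term_ge0. Qed.

Lemma measurable_wsum (w : nat -> R) (A : nat -> set T) :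
  (forall n, (0 <= w n)%R) -> (forall n, measurable (A n)) ->
  measurable_fun [set: T] (wsum w A).
Proof.
move=> w0 mA; apply: (@ge0_emeasurable_sum _ _ _ _
    (fun n x => (w n)%:E * (\1_(A n) x)%:E) xpredT) => [n x _ _|n _].
  exact: wsum_term_ge0.
apply: emeasurable_funM; first exact: measurable_cst.
by apply/measurable_EFinP; exact: measurable_indic.
Qed.

Lemma integral_wsum (w : nat -> R) (A : nat -> set T) :
  (forall n, (0 <= w n)%R) -> (forall n, measurable (A n)) ->
  \int[mu]_x wsum w A x = \sum_(0 <= n <oo) (w n)%:E * mu (A n).
Proof.
move=> w0 mA; rewrite integral_nneseries//; last 2 first.
- move=> n; apply: emeasurable_funM; first exact: measurable_cst.
  by apply/measurable_EFinP; exact: measurable_indic.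
- by move=> n x _; exact: wsum_term_ge0.
apply: eq_eseriesr => n _; rewrite ge0_integralZl_EFin//.
- by rewrite integral_indic// setIT.
- by apply/measurable_EFinP; exact: measurable_indic.
Qed.

Lemma integral_wsum_le (w : nat -> R) (A : nat -> set T) (e : R) :
  (forall n, (0 <= w n)%R) -> (forall n, measurable (A n)) -> (0 <= e)%R ->
  (forall n, (w n)%:E * mu (A n) <= (e / (2 ^ n.+1)%:R)%:E) ->
  \int[mu]_x wsum w A x <= e%:E.
Proof.
move=> w0 mA e0 h; rewrite integral_wsum//.
apply: (@le_trans _ _ (\sum_(0 <= n <oo) (e / (2 ^ n.+1)%:R)%:E)).
  by apply: lee_nneseries => n // _; rewrite mule_ge0// lee_fin.
exact: epsilon_trick0.
Qed.

Lemma wsum_ge (w : nat -> R) (A : nat -> set T) n x :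
  (forall n, (0 <= w n)%R) -> A n x -> (w n)%:E <= wsum w A x.
Proof.
move=> w0 Ax; rewrite /wsum (@nneseriesD1 _ _ n xpredT)//; last first.
  by move=> k _; exact: wsum_term_ge0.
rewrite indicE mem_set// mule1 leeDl//.
by apply: nneseries_ge0 => k _ _; exact: wsum_term_ge0.
Qed.

Lemma le_wsum (w : nat -> R) (A B : nat -> set T) x y :
  (forall n, (0 <= w n)%R) -> (forall n, A n x -> B n y) ->
  wsum w A x <= wsum w B y.
Proof.
move=> w0 AB; apply: lee_nneseries => n.
  by move=> _ _; exact: wsum_term_ge0.
move=> _; apply: lee_wpmul2l; rewrite lee_fin// !indicE ler_nat.
have [/set_mem/AB/mem_set ->//|//] := boolP (x \in A n).
Qed.

Lemma measurable_level (h : T -> R) (t : R) : measurable_fun [set: T] h ->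
  measurable [set x | (t <= `|h x|)%R].
Proof.
move=> mh; have mh' : measurable_fun [set: T] (fun x => `|h x|%R).
  exact: measurableT_comp.
rewrite (_ : [set _ | _] = [set: T] `&` (fun x => `|h x|%R) @^-1` `[t, +oo[%classic).
  exact: mh'.
by rewrite setTI; apply/seteqP; split => x /=; rewrite in_itv/= andbT.
Qed.

(** Chebyshev's inequality with [r = 1/q], and [r = 0] when [q = +oo], where a level set of positive
    measure bounds the essential supremum from below. The real exponent [r] lets both cases be used
    alike. *)
Lemma Lnorm_ge_level (p : R) (q : \bar R) : (0 < p)%R -> p%:E < q ->
  exists r : R, [/\ (0 <= r)%R, (r < p^-1)%R &
    forall (h : T -> R) (t b : R), measurable_fun [set: T] h ->
      (0 < t)%R -> (0 < b)%R -> b%:E <= mu [set x | (t <= `|h x|)%R] ->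
      (t * b `^ r)%:E <= Lnorm mu q (EFin \o h)].
Proof.
move=> p0; case: q => [q||//].
- rewrite lte_fin => pq; have q0 := lt_trans p0 pq.
  exists q^-1%R; split; rewrite ?invr_ge0 ?(ltW q0)//.
    by rewrite ltf_pV2.
  move=> h t b mh t0 b0 bmu.
  have mh' : measurable_fun [set: T] (EFin \o h) by apply/measurable_EFinP.
  have := @le_integral_comp_abse _ _ _ mu _ measurableT (EFin \o h) t
    (poweR ^~ q) (@measurable_poweR _ q) (fun r _ => poweR_ge0 r q) _ mh' t0.
  have nd : {in `[0, +oo[%classic &, {homo (poweR ^~ q) : x y / x <= y}}.
    move=> x y; rewrite !inE/= !in_itv/= !andbT => x0 y0 xy.
    by apply: gt0_ler_poweR => //; rewrite ?in_itv/= ?andbT ?leey ?x0 ?y0// ltW.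
  move=> /(_ nd); rewrite setTI poweR_EFin => le1.
  rewrite unlock /=.
  have -> : ((t * b `^ q^-1)%:E = ((t `^ q)%:E * b%:E) `^ q^-1).
    rewrite -EFinM poweR_EFin powRM ?powR_ge0 ?(ltW b0)// -powRrM mulfV ?gt_eqF//.
    by rewrite powRr1// ltW.
  apply: gt0_ler_poweR; rewrite ?invr_ge0 ?(ltW q0)//.
  + by rewrite in_itv/= leey mule_ge0// lee_fin ?powR_ge0// ltW.
  + by rewrite in_itv/= leey integral_ge0// => x _; exact: poweR_ge0.
  apply: le_trans le1; apply: lee_wpmul2l; first by rewrite lee_fin powR_ge0.
  by under eq_set do rewrite /= lee_fin.
- move=> _; exists 0%R; split; rewrite ?invr_gt0//.
  move=> h t b mh t0 b0 bmu; rewrite powRr0 mulr1 unlock.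
  have bT : 0 < mu [set: T].
    apply: lt_le_trans (_ : b%:E <= _); first by rewrite lte_fin.
    by apply: le_trans bmu _; apply: le_measure; rewrite ?inE//;
      exact: measurable_level.
  rewrite bT leNgt; apply/negP => lt_t.
  have : {ae mu, forall x, (`|h x| < t)%R}.
    have := @ess_sup_ge _ _ _ mu (abse \o (EFin \o h)).
    by apply: filterS => x /= /le_lt_trans/(_ lt_t); rewrite lte_fin.
  move=> /negligibleP; rewrite (_ : ~` _ = [set x | (t <= `|h x|)%R]); last first.
    by apply/seteqP; split => x /=; [move/negP; rewrite -leNgt|rewrite leNgt => /negP].
  move=> /(_ (measurable_level _ mh)) mu0.
  by move: bmu; rewrite mu0 lee_fin leNgt b0.
Qed.

End measure_preliminaries.

Section borel.
Variables (X : ptopologicalType).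

Lemma borel_open (U : set X) : open U -> measurable (U : set (Borel X)).
Proof. by move=> oU; apply: sub_sigma_algebra. Qed.

Lemma borel_closed (U : set X) : closed U -> measurable (U : set (Borel X)).
Proof.
move=> cU; rewrite -[U]setCK; apply: measurableC; apply: borel_open.
exact: closed_openC.
Qed.

Lemma borel_continuous (Y : ptopologicalType) (f : X -> Y) : continuous f ->
  measurable_fun [set: Borel X] (f : Borel X -> Borel Y).
Proof.
move=> cf; apply: (@measurability _ _ (Borel X) (Borel Y) setT f (@open Y)) => //.
move=> _ [B oB <-]; rewrite setTI; apply: borel_open.
by apply: open_comp => // x _; exact: cf.
Qed.

Lemma borel_continuous_real (R : realType) (f : X -> R) : continuous f ->
  measurable_fun [set: Borel X] (f : Borel X -> R).
Proof.
move=> cf; apply: (@measurability _ _ (Borel X) R setT f _ (RGenOpens.measurableE R)).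
move=> _ [_ [a [b ->] <-]]; rewrite setTI; apply: borel_open.
by apply: open_comp => [x _|]; [exact: cf|exact: interval_open].
Qed.

End borel.

(** * Measures of translates, and almost everywhere finiteness of convolutions *)

Section sobolev.
Variables (R : realType) (X : ptopologicalType).
Local Notation G := (PSL2 R).
Variables (act : G -> X -> X) (mu : {measure set (Borel X) -> \bar R}).
Hypothesis actP : is_Gspace act.
Hypothesis mu1 : mu [set: Borel X] = 1%E.
Hypothesis mu_inv : forall (g : G) (A : set (Borel X)), measurable A ->
  mu (act g @^-1` A) = mu A.

Lemma image_act g (A : set X) : act g @` A = act (psl_inv g) @^-1` A.
Proof.
apply/seteqP; split => [_ [x Ax <-]|x Ax] /=; first by rewrite (actK actP).
by exists (act (psl_inv g) x) => //; rewrite (actKV actP).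
Qed.

Lemma mu_act g (A : set (Borel X)) : measurable A -> mu (act g @` A) = mu A.
Proof. by move=> mA; rewrite image_act mu_inv. Qed.

Lemma measurable_act g (A : set (Borel X)) : measurable A ->
  measurable (act g @` A : set (Borel X)).
Proof.
move=> mA; rewrite image_act -[_ @^-1` _]setTI.
exact: (borel_continuous (act_continuous actP (g := psl_inv g))).
Qed.

Lemma mu_le1 (A : set (Borel X)) : measurable A -> (mu A <= 1)%E.
Proof. by move=> mA; rewrite -mu1; apply: le_measure; rewrite ?inE. Qed.

Lemma mu_saturate_doubling (V : set G) (s : seq G) (U : set X) :
  (forall g h, V g -> V h ->
    exists2 k, k \in s & V (psl_mul (psl_inv k) (psl_mul g h))) ->
  open U ->
  (mu (saturate act V (saturate act V U)) <=
    (size s)%:R%:E * mu (saturate act V U))%E.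
Proof.
move=> sV oU; set W := saturate act V U.
have oW : open W by exact: open_saturate.
have mW : measurable (W : set (Borel X)) by exact: borel_open.
pose F i := act (nth (psl_one R) s i) @` W.
have := @content_subadditive _ _ _ mu (saturate act V W) F (size s).
have -> : (\sum_(k < size s) mu (F k) = (size s)%:R%:E * mu W)%E.
  under eq_bigr do rewrite mu_act//.
  by rewrite sumr_const card_ord mule_natl.
apply.
- by move=> k _; exact: measurable_act.
- by apply: borel_open; exact: open_saturate.
- move=> _ [g Vg [_ [h Vh [x Ux <-]] <-]].
  have [k ks Vk] := sV g h Vg Vh.
  rewrite -bigcup_mkord; exists (index k s); first by rewrite /= index_mem.
  rewrite /F nth_index//; exists (act (psl_mul (psl_inv k) (psl_mul g h)) x).
    by exists (psl_mul (psl_inv k) (psl_mul g h)) => //; exists x.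
  by rewrite !(actM actP) (actKV actP).
Qed.

(** Countably many translates of [V] cover [G], so if [V] were null, every Borel set would be. *)
Lemma haar_gt0 (m : {measure set (Borel G) -> \bar R}) (V : set G) :
  haar_measure m -> open V -> V (psl_one R) -> (0 < m (V : set (Borel G)))%E.
Proof.
move=> [[A [mA A0]] mL _] oV V1; rewrite lt0e measure_ge0 andbT.
apply/negP => /eqP mV0.
have mV : measurable (V : set (Borel G)) by exact: borel_open.
have [gi giP] := psl_countable_cover (open_nbhs_nbhs (conj oV V1)).
pose F i : set (Borel G) := psl_mul (psl_inv (gi i)) @^-1` V.
have mF i : measurable (F i).
  apply: borel_open; apply: open_comp => // h _.
  exact: psl_mull_continuous.
have AF : A `<=` \bigcup_i F i by move=> h _; have [i Vi] := giP h; exists i.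
have := measure_sigma_subadditive m mF mA AF.
rewrite eseries0; last by move=> i _ _; rewrite /F mL.
by move=> /(lt_le_trans A0); rewrite ltxx.
Qed.

(* Stands in for Tonelli's theorem, whose joint measurability assumption may fail
   when [X] is not second countable: [G] is cut into countably many pieces, on
   each of which [f (g^-1 x)] is dominated by a function of [x] alone. *)
Lemma convolution_finite (m : {measure set (Borel G) -> \bar R}) (phi : G -> R)
    (V : set G) (gi : nat -> G) (f : Borel X -> R) (F : nat -> Borel X -> \bar R)
    (e : R) :
  continuous phi -> (forall g, 0 <= phi g) ->
  m.-integrable [set: Borel G] (EFin \o phi) ->
  open V -> (forall h, exists i, V (psl_mul (psl_inv (gi i)) h)) ->
  measurable_fun [set: Borel X] f -> (forall x, 0 <= f x) ->
  (forall i, measurable_fun [set: Borel X] (F i)) ->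
  (forall i x, 0 <= F i x)%E ->
  (forall i, \int[mu]_x F i x <= e%:E)%E ->
  (forall i g x, V (psl_mul (psl_inv (gi i)) g) ->
     (f (act (psl_inv g) x))%:E <= 1 + F i x)%E ->
  {ae mu, forall x, (forall i, F i x < +oo)%E /\
    (\int[m]_(g in [set: Borel G]) (phi g * f (act (psl_inv g) x))%:E < +oo)%E}.
Proof.
move=> cphi phi0 iphi oV giV mf f0 mF F0 Fe fF.
(* Disjoint Borel pieces of [G], the [i]-th one inside [gi i V], where [F i] dominates. *)
pose P : nat -> set (Borel G) := seqDU (fun i => psl_mul (psl_inv (gi i)) @^-1` V).
have mP i : measurable (P i).
  apply: seqDU_measurable => k; apply: borel_open; apply: open_comp => // h _.
  exact: psl_mull_continuous.
have PT : \bigcup_i P i = [set: Borel G].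
  rewrite -seqDU_bigcup_eq; apply/seteqP; split => // h _.
  by have [i Vi] := giV h; exists i.
have mphi : measurable_fun [set: Borel G] (EFin \o phi).
  by have /integrableP[] := iphi.
pose a i := (\int[m]_(g in P i) (phi g)%:E)%E.
have a0 i : (0 <= a i)%E by apply: integral_ge0 => g _; rewrite lee_fin.
have aS : (\sum_(0 <= i <oo) a i = \int[m]_g (phi g)%:E)%E.
  rewrite -PT ge0_integral_bigcup ?PT//; last exact: trivIset_seqDU.
  by move=> g _; rewrite lee_fin.
have philty : (\int[m]_g (phi g)%:E < +oo)%E.
  have /integrableP[_] := iphi; apply: le_lt_trans; apply: ge0_le_integral => //.
  - by move=> g _; rewrite lee_fin.
  - exact: measurableT_comp.
  - by move=> g _ /=; rewrite ger0_norm.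
have alty i : (a i < +oo)%E.
  apply: le_lt_trans philty; apply: ge0_subset_integral => //.
  by move=> g _; rewrite lee_fin.
have aE i : a i = (fine (a i))%:E by rewrite fineK// ge0_fin_numE.
(* The added [1 / 2 ^ i.+1] keeps the weight positive when [phi] has integral 0 on a piece:
   finiteness of the weighted sum then forces every [F i x] to be finite. *)
pose w i : R := fine (a i) + 1 / (2 ^ i.+1)%:R.
have w_gt0 i : 0 < w i.
  by rewrite ltr_wpDl ?fine_ge0// divr_gt0// ltr0n expn_gt0.
(* On the [i]-th piece the integral is at most [a i * (1 + F i x)], so [S x] bounds the convolution
   at [x]. The integral of [S] is at most [1 + e] times the integral of [phi] plus 1. *)
pose S x := (\sum_(0 <= i <oo) ((w i)%:E * (1 + F i x)))%E.
have T0 i x : (0 <= (w i)%:E * (1 + F i x))%E.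
  by rewrite mule_ge0 ?adde_ge0// lee_fin ltW.
have mT i : measurable_fun [set: Borel X] (fun x => (w i)%:E * (1 + F i x))%E.
  apply: emeasurable_funM; first exact: measurable_cst.
  by apply: emeasurable_funD => //; exact: measurable_cst.
have mS : measurable_fun [set: Borel X] S.
  by apply: (@ge0_emeasurable_sum _ _ _ _ (fun i x => (w i)%:E * (1 + F i x))%E xpredT).
have Slty : (\int[mu]_x S x < +oo)%E.
  rewrite integral_nneseries//.
  apply: (@le_lt_trans _ _ (\sum_(0 <= i <oo)
      ((1 + e)%:E * (a i + (1 / (2 ^ i.+1)%:R)%:E)))%E).
    apply: lee_nneseries => [i _ _|i _]; first exact: integral_ge0.
    rewrite ge0_integralZl_EFin ?(ltW (w_gt0 i))//; last 2 first.
    - by move=> x _; rewrite adde_ge0.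
    - by apply: emeasurable_funD => //; exact: measurable_cst.
    rewrite muleC aE -EFinD -/(w i); apply: lee_wpmul2r.
      by rewrite lee_fin ltW.
    rewrite ge0_integralD//.
    by rewrite integral_cst// mul1e mu1 EFinD leeD2l.
  have e0 : (0 <= e%:E)%E by apply: le_trans (Fe 0%N); exact: integral_ge0.
  rewrite nneseriesZl; last first.
    by move=> i _; rewrite adde_ge0// lee_fin divr_ge0.
  rewrite lte_mul_pinfty//; first by rewrite EFinD adde_ge0.
  apply: le_lt_trans (epsilon_trick _ a0 ler01) _.
  by rewrite aS lte_add_pinfty// ltry.
have iS : mu.-integrable [set: Borel X] S.
  apply/integrableP; split => //.
  under eq_integral do rewrite gee0_abs ?nneseries_ge0//.
  exact: Slty.
have /integrable_ae-/(_ measurableT) := iS.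
apply: filterS => x /(_ Logic.I); rewrite fin_numElt => /andP[_ Sx].
have Fx i : (F i x < +oo)%E.
  have Ti : ((w i)%:E * (1 + F i x) <= S x)%E.
    rewrite /S (@nneseriesD1 _ _ i xpredT)// leeDl//.
    by apply: nneseries_ge0 => k _ _.
  rewrite ltey; apply/eqP => Foo; move: Ti; rewrite Foo addey// mulry.
  by rewrite gtr0_sg// mul1e leNgt Sx.
split => //.
have mfx : measurable_fun [set: Borel G]
    (fun g => (phi g * f (act (psl_inv g) x))%:E).
  apply/measurable_EFinP; apply: measurable_funM.
    by apply/measurable_EFinP.
  apply: (@measurableT_comp _ _ _ _ _ _ f) => //.
  apply: (@borel_continuous _ _ (fun g => act (psl_inv g) x)) => g.
  apply: (@continuous_comp _ _ _ (@psl_inv R) (act^~ x)).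
    exact: psl_inv_continuous.
  exact: act_orbit_continuous.
apply: le_lt_trans Sx.
rewrite -PT ge0_integral_bigcup ?PT//; last 2 first.
- by move=> g _; rewrite lee_fin mulr_ge0.
- exact: trivIset_seqDU.
apply: lee_nneseries => i _.
  by move=> _; apply: integral_ge0 => g _; rewrite lee_fin mulr_ge0.
have F1x : ((1 + F i x) = (fine (1 + F i x))%:E)%E.
  by rewrite fineK// ge0_fin_numE ?adde_ge0// lte_add_pinfty// ltry.
apply: (@le_trans _ _ (\int[m]_(g in P i) ((fine (1 + F i x))%:E * (phi g)%:E))%E).
  apply: ge0_le_integral => //.
  - by move=> g _; rewrite lee_fin mulr_ge0.
  - exact: measurable_funTS.
  - apply: emeasurable_funM; first exact: measurable_cst.
    exact: measurable_funTS.
  - move=> g Pg; rewrite EFinM muleC; apply: lee_wpmul2r; rewrite ?lee_fin//.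
    rewrite -lee_fin -F1x; apply: fF.
    exact: (subset_seqDU Pg).
rewrite ge0_integralZl_EFin//; last 3 first.
- by move=> g _; rewrite lee_fin.
- exact: measurable_funTS.
- by rewrite fine_ge0// adde_ge0.
rewrite -F1x muleC; apply: lee_wpmul2r; first by rewrite adde_ge0.
by rewrite -/(a i) aE lee_fin /w lerDl divr_ge0.
Qed.

End sobolev.

Section sobolev_bound.
Variables (R : realType) (X : ptopologicalType).
Local Notation G := (PSL2 R).
Variables (act : G -> X -> X) (mu : {measure set (Borel X) -> \bar R}).
Hypothesis actP : is_Gspace act.
Hypothesis mu1 : mu [set: Borel X] = 1%E.
Hypothesis mu_inv : forall (g : G) (A : set (Borel X)), measurable A ->
  mu (act g @^-1` A) = mu A.
Hypothesis mu_supp : forall U : set X, open U -> U !=set0 -> (0 < mu U)%E.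

Lemma le_fine_ge0 (x : \bar R) : (0 <= x -> (fine x)%:E <= x)%E.
Proof. by case: x => //= r _; exact: leey. Qed.

(** For [f = F^(1/p)] this gives [f <= 1 + F], the domination that [convolution_finite] asks for. *)
Lemma powR_inv_le1D (p y : R) : 1 <= p -> 0 <= y -> y `^ p^-1 <= 1 + y.
Proof.
move=> p1 y0; have p0 : 0 < p by exact: lt_le_trans p1.
have ip1 : p^-1 <= 1 by rewrite invf_le1.
have [y1|/ltW y1] := leP y 1; last by rewrite (le_trans (ler1_powR y1 ip1))// lerDr.
apply: (@le_trans _ _ 1); last by rewrite lerDl.
have <- : 1 `^ p^-1 = 1 :> R by rewrite powR1.
by rewrite ge0_ler_powR ?invr_ge0 ?(ltW p0)// nnegrE.
Qed.

(** Symmetry serves the lower bound on the convolution: if [x = g1 y] and [g = g1 h] with [h] in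
    [V], then [g^-1 x = h^-1 y] lies in [V y]. The compact [K] controls products of elements of [V],
    and later the disjointness of translates. *)
Lemma sobolev_nbhs (phi : G -> R) (g1 : G) : continuous phi -> 0 < phi g1 ->
  exists V K : set G, [/\ compact K, V `<=` K, open V, V (psl_one R) &
    (forall h, V h -> V (psl_inv h)) /\
    (forall h, V h -> phi g1 / 2 <= phi (psl_mul g1 h))].
Proof.
move=> cphi phig1.
have half : phi g1 / 2 < phi g1 by rewrite gtr_pMr// invf_lt1// ltr1n.
have nphi : nbhs g1 (phi @^-1` [set x | phi g1 / 2 < x]).
  exact: (cphi g1 _ (lt_nbhsr half)).
have : nbhs (psl_one R) (psl_mul g1 @^-1` (phi @^-1` [set x | phi g1 / 2 < x])).
  by apply: psl_mull_continuous; rewrite psl_mulg1.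
move=> /psl_compact_nbhs1[K [cK nK Kphi]].
exists (K^° `&` (@psl_inv R @^-1` K^°)), K; split => //.
- by move=> h [/interior_subset].
- apply: openI; first exact: open_interior.
  apply: open_comp; last exact: open_interior.
  by move=> h _; exact: psl_inv_continuous.
- by split => //=; rewrite psl_inv1.
split.
  by move=> h [Kh Kh'] /=; split => //=; rewrite psl_invK.
by move=> h [/interior_subset/Kphi/ltW].
Qed.

Lemma sobolev_lower_bound : qualitative_Sobolev act mu ->
  exists (V K : set G) (e : R), [/\ compact K, V `<=` K, 0 < e &
    forall U : set X, open U -> U !=set0 -> (e%:E <= mu (saturate act V U))%E].
Proof.
move=> [p [q [p1 pq [m [phi [hm [cphi phi0 [g1 phig1]] iphi Sob]]]]]].
have p0 : 0 < p by exact: lt_le_trans p1.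
have {}phig1 : 0 < phi g1 by rewrite lt_def phig1 phi0.
have [V [K [cK VK oV V1 [VV Vphi]]]] := sobolev_nbhs cphi phig1.
set c := phi g1 / 2 in Vphi; have c0 : 0 < c by rewrite divr_gt0.
have nV : nbhs (psl_one R) V by exact: open_nbhs_nbhs.
have [s sP] := psl_finite_cover (compact_psl_mul cK cK) nV.
have {}sP g h : V g -> V h ->
    exists2 k, k \in s & V (psl_mul (psl_inv k) (psl_mul g h)).
  by move=> Vg Vh; apply: sP; exists g; [exact: VK|exists h => //; exact: VK].
have [gi giV] := psl_countable_cover nV.
have [k0 [k00 k0V]] : exists k0, 0 < k0 /\ (k0%:E <= m (V : set (Borel G)))%E.
  have := haar_gt0 hm oV V1; case: (m V) => [k| |]//.
    by rewrite lte_fin => k_gt0; exists k.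
  by move=> _; exists 1; rewrite leey.
have [r [r0 rp Lr]] := Lnorm_ge_level mu p0 pq.
apply: contrapT => nex.
(* The gap between the exponents. The sets [U n] are chosen so that [b n ^ z <= 4^-n], which
   outweighs the factors [2^-n] that make the series for [F] integrable. *)
pose z := p^-1 - r; have z0 : 0 < z by rewrite subr_gt0.
have small n : exists U : set X, [/\ open U, U !=set0 &
    (mu (saturate act V U) < (((4 ^+ n)^-1) `^ z^-1)%:E)%E].
  apply: contrapT => nU; apply: nex; exists V, K, (((4 ^+ n)^-1) `^ z^-1).
  split => //.
  move=> U oU U0; rewrite leNgt; apply/negP => lt; apply: nU.
  by exists U; split.
have /choice[U UP] := small.
have oU n : open (U n) by case: (UP n).
pose A n := saturate act V (U n).
have oA n : open (A n) by exact: open_saturate.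
have mA n : measurable (A n : set (Borel X)) by exact: borel_open.
pose b n := fine (mu (A n)).
have muA n : mu (A n) = (b n)%:E.
  by rewrite fineK// ge0_fin_numE// (le_lt_trans (mu_le1 mu1 (mA n)))// ltry.
have b0 n : 0 < b n.
  rewrite -lte_fin -muA; apply: mu_supp => //.
  by case: (UP n) => _ [x Ux] _; exists (act (psl_one R) x), (psl_one R) => //; exists x.
have bz n : b n `^ z <= (4 ^+ n)^-1.
  case: (UP n) => _ _; rewrite -/(A n) muA lte_fin => /ltW b4.
  have -> : (4 ^+ n)^-1 = ((4 ^+ n)^-1 `^ z^-1) `^ z.
    by rewrite -powRrM mulVf ?lt0r_neq0// powRr1// invr_ge0 exprn_ge0.
  by rewrite ge0_ler_powR ?nnegrE ?powR_ge0 ?(ltW z0) ?(ltW (b0 n)).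
(* [F] lives on the sets [B n]. The second thickening is for domination: if [g] lies in [gi i V] and
   [g^-1 x] in [B n], then [(gi i)^-1 x] lies in [V (B n) = B' n]. *)
pose B n := saturate act V (A n); pose B' n := saturate act V (B n).
have oB n : open (B n) by exact: open_saturate.
have oB' n : open (B' n) by exact: open_saturate.
pose D : R := (size s)%:R.
have D0 : 0 <= D by rewrite ler0n.
have muB n : (mu (B n) <= (D * b n)%:E)%E.
  by rewrite EFinM -muA; exact: mu_saturate_doubling.
have muB' n : (mu (B' n) <= (D * (D * b n))%:E)%E.
  rewrite EFinM; apply: (@le_trans _ _ (D%:E * mu (B n)))%E.
    exact: mu_saturate_doubling.
  by apply: lee_wpmul2l; rewrite ?lee_fin.
(* The weight [w n] makes the [n]-th term of [F] of mass at most [D / 2 ^ n.+1],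
   while [phi * f] is at least a multiple of [w n `^ p^-1] on a translate of [A n]. *)
pose w n := ((2 ^ n.+1)%:R * b n)^-1.
have two n : 0 < (2 ^ n.+1)%:R :> R by rewrite ltr0n expn_gt0.
have w0 n : 0 < w n by rewrite invr_gt0 mulr_gt0.
have w0' n : 0 <= w n by rewrite ltW.
have wb n (y : \bar R) d : (y <= (d * b n)%:E)%E ->
    ((w n)%:E * y <= (d / (2 ^ n.+1)%:R)%:E)%E.
  move=> yd; apply: (@le_trans _ _ ((w n)%:E * (d * b n)%:E)%E).
    by apply: lee_wpmul2l; rewrite ?lee_fin.
  by rewrite -EFinM lee_fin /w invfM mulrACA mulVf ?gt_eqF// mulr1 mulrC.
pose F := wsum w (fun n => B n : set (Borel X)).
pose Fi i := wsum w (fun n => act (gi i) @` B' n : set (Borel X)).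
have mB n : measurable (B n : set (Borel X)) by exact: borel_open.
have mB' n : measurable (B' n : set (Borel X)) by exact: borel_open.
have mF : measurable_fun [set: Borel X] F by exact: measurable_wsum.
have mFi i : measurable_fun [set: Borel X] (Fi i).
  by apply: measurable_wsum => // n; exact: measurable_act.
have F0 x : (0 <= F x)%E by exact: wsum_ge0.
have FFi i g x : V (psl_mul (psl_inv (gi i)) g) ->
    (F (act (psl_inv g) x) <= Fi i x)%E.
  move=> Vg; apply: le_wsum => // n Bx.
  exists (act (psl_inv (gi i)) x); last by rewrite (actKV actP).
  exists (psl_mul (psl_inv (gi i)) g) => //; exists (act (psl_inv g) x) => //.
  by rewrite (actM actP) (actKV actP).
(* Where [F] is infinite, [fine] makes [f] equal to 0; pointwise lower bounds on [f] thus need [F]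
   finite. *)
pose f (x : Borel X) : R := fine (F x) `^ p^-1.
have mf : measurable_fun [set: Borel X] f.
  apply: (@measurableT_comp _ _ _ _ _ _ (fun y : R => y `^ p^-1)).
    exact: measurable_powR.
  exact: (measurableT_comp (fine_measurable measurableT) mF).
have Lf : (Lnorm mu p%:E (EFin \o f) < +oo)%E.
  rewrite unlock; apply: poweR_lty.
  apply: (@le_lt_trans _ _ D%:E); last exact: ltry.
  apply: (@le_trans _ _ (\int[mu]_x F x)%E); last first.
    by apply: integral_wsum_le => // n; exact: wb.
  apply: ge0_le_integral => //.
  - by move=> x _; exact: poweR_ge0.
  - apply: (@measurableT_comp _ _ _ _ _ _ (fun y => poweR y p)).
      exact: measurable_poweR.
    by apply: measurableT_comp => //; exact/measurable_EFinP.
  - move=> x _ /=; rewrite ger0_norm ?powR_ge0// -powRrM mulVf ?gt_eqF//.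
    by rewrite powRr1 ?fine_ge0// le_fine_ge0.
have [h [mh Lh aeh]] := Sob f mf Lf.
have aefin := @convolution_finite _ _ _ mu actP mu1 m phi V gi f Fi (D * D)
  cphi phi0 iphi oV giV mf (fun x => powR_ge0 _ _) mFi.
have {aefin} : {ae mu, forall x : Borel X, (forall i, Fi i x < +oo)%E /\
    (\int[m]_(g in [set: Borel G]) (phi g * f (act (psl_inv g) x))%:E < +oo)%E}.
  apply: aefin.
  - by move=> i x; exact: wsum_ge0.
  - move=> i; apply: integral_wsum_le => //.
    + by move=> n; exact: measurable_act.
    + exact: mulr_ge0.
    + by move=> n; apply: wb; rewrite mu_act// -mulrA.
  - move=> i g x Vg; apply: (@le_trans _ _ (1 + F (act (psl_inv g) x)))%E.
      apply: (@le_trans _ _ (1 + (fine (F (act (psl_inv g) x)))%:E))%E.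
        by rewrite -EFinD lee_fin powR_inv_le1D// fine_ge0.
      by apply: leeD2l; exact: le_fine_ge0.
    by apply: leeD2l; exact: FFi.
move=> aefin.
pose t n := c * k0 * (w n) `^ p^-1.
have t0 n : 0 < t n by rewrite !mulr_gt0// powR_gt0.
(* Both finiteness assumptions guard against [fine], which sends [+oo] to 0, in [f] and in
   [convolution]. The integral is restricted to [g] in [g1 V], of mass at least [k0]: there
   [phi >= c], and [g^-1 x] lies in [V (A n) = B n]. *)
have conv_ge n x : (forall i, Fi i x < +oo)%E ->
    (\int[m]_(g in [set: Borel G]) (phi g * f (act (psl_inv g) x))%:E < +oo)%E ->
    (act g1 @` A n) x -> t n <= convolution act m phi f x.
  move=> Fx Ix [y Ay yx].
  have mI : measurable_fun [set: Borel G]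
      (fun g => (phi g * f (act (psl_inv g) x))%:E).
    apply/measurable_EFinP; apply: measurable_funM.
      by apply: borel_continuous_real.
    apply: (@measurableT_comp _ _ _ _ _ _ f) => //.
    apply: (@borel_continuous _ _ (fun g => act (psl_inv g) x)) => g.
    apply: (@continuous_comp _ _ _ (@psl_inv R) (act^~ x)).
      exact: psl_inv_continuous.
    exact: act_orbit_continuous.
  have I0 g : (0 <= (phi g * f (act (psl_inv g) x))%:E)%E.
    by rewrite lee_fin mulr_ge0// powR_ge0.
  rewrite /convolution -lee_fin fineK; last first.
    by rewrite ge0_fin_numE// integral_ge0.
  pose V1' : set (Borel G) := psl_mul (psl_inv g1) @^-1` V.
  have mV1 : measurable V1'.
    by apply: borel_open; apply: open_comp => // g _; exact: psl_mull_continuous.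
  have mV1E : m V1' = m (V : set (Borel G)).
    by case: hm => _ mL _; rewrite mL//; exact: borel_open.
  apply: (@le_trans _ _ (\int[m]_(g in V1') (phi g * f (act (psl_inv g) x))%:E)%E);
    last by apply: ge0_subset_integral.
  apply: (@le_trans _ _ (\int[m]_(g in V1') (cst ((c * w n `^ p^-1)%:E) g))%E).
    rewrite integral_cst// mV1E /t mulrAC EFinM.
    by apply: lee_wpmul2l; rewrite ?lee_fin ?mulr_ge0 ?powR_ge0// ltW.
  apply: ge0_le_integral => //.
  - by move=> g _; rewrite lee_fin ?mulr_ge0 ?powR_ge0// ltW.
  - exact: measurable_funTS.
  move=> g Vg; rewrite lee_fin; apply: ler_pM; rewrite ?powR_ge0 ?(ltW c0)//.
    by rewrite -(psl_mulKVg g1 g); exact: Vphi.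
  have [i Vi] := giV g.
  have Ffin : (F (act (psl_inv g) x) < +oo)%E.
    by apply: le_lt_trans (Fx i); exact: FFi.
  apply: ge0_ler_powR; rewrite ?invr_ge0 ?nnegrE ?fine_ge0// ?(ltW p0)//.
  rewrite -lee_fin fineK ?ge0_fin_numE//; apply: wsum_ge => //.
  exists (psl_inv (psl_mul (psl_inv g1) g)); first exact: VV.
  by exists y => //; rewrite -yx psl_invM psl_invK (actM actP).
have level n : ((b n)%:E <= mu [set x | (t n <= `|h x|)%R])%E.
  have [N [mN N0 sN]] : mu.-negligible (~` [set x : Borel X |
      ((forall i, Fi i x < +oo)%E /\
       (\int[m]_(g in [set: Borel G]) (phi g * f (act (psl_inv g) x))%:E < +oo)%E)
      /\ convolution act m phi f x = h x]) := filterI aefin aeh.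
  rewrite -muA -(mu_act actP mu_inv g1)//.
  have ml := measurable_level (t n) mh.
  apply: (@le_trans _ _ (mu ([set x | (t n <= `|h x|)%R] `|` N))%E).
    apply: le_measure; rewrite ?inE; [exact: measurable_act|exact: measurableU|].
    move=> x Ax; have [Nx|Nx] := pselect (N x); [by right|left => /=].
    have [[Fx Ix] <-] : ((forall i, Fi i x < +oo)%E /\
       (\int[m]_(g in [set: Borel G]) (phi g * f (act (psl_inv g) x))%:E < +oo)%E)
      /\ convolution act m phi f x = h x.
      by apply: contrapT => nP; apply: Nx; apply: sN.
    by rewrite (le_trans (conv_ge n x Fx Ix Ax))// ler_norm.
  by apply: le_trans (measureU2 _ ml mN) _; rewrite [X in (_ + X)%E]N0 adde0.
have Lbound n : ((t n * b n `^ r)%:E <= Lnorm mu q (EFin \o h))%E by exact: Lr.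
have ip1 : p^-1 <= 1 by rewrite invf_le1.
(* The powers of [b n] combine to [b n ^ (- z) >= 4^n], and [(2^-(n+1)) ^ (1/p) >= 2^-(n+1)] since
   [1/p <= 1]; the product grows like [2^n]. *)
have tb n : c * k0 / 2 * 2 ^+ n <= t n * b n `^ r.
  rewrite /t /w invfM powRM ?invr_ge0 ?(ltW (b0 n)) ?(ltW (two n))//.
  have -> : (b n)^-1 `^ p^-1 = b n `^ (- p^-1).
    by rewrite -(powR_inv1 (ltW (b0 n))) -powRrM mulN1r.
  have -> : c * k0 * ((2 ^ n.+1)%:R^-1 `^ p^-1 * b n `^ (- p^-1)) * b n `^ r =
      c * k0 * ((2 ^ n.+1)%:R^-1 `^ p^-1 * (b n `^ z)^-1).
    have zE : - z = - p^-1 + r by rewrite opprB addrC.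
    rewrite -powRN zE powRD; last by apply/implyP => _; rewrite gt_eqF.
    by rewrite !mulrA.
  have -> : c * k0 / 2 * 2 ^+ n = c * k0 * ((2 ^ n.+1)%:R^-1 * 4 ^+ n).
    rewrite (_ : 4 = 2 * 2 :> R); last by ring.
    rewrite exprMn natrX exprS; field.
    by rewrite expf_neq0// pnatr_eq0.
  apply: ler_wpM2l; first by rewrite mulr_ge0 ?ltW.
  apply: ler_pM; rewrite ?invr_ge0 ?exprn_ge0 ?(ltW (two n))//.
    apply: ger1_powR => //; rewrite invr_gt0 two /= invf_le1//.
    by rewrite ler1n expn_gt0.
  by rewrite -[leLHS]invrK lef_pV2 ?posrE ?invr_gt0 ?exprn_gt0 ?powR_gt0.
have [y yE] : exists y, Lnorm mu q (EFin \o h) = y%:E.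
  by exists (fine (Lnorm mu q (EFin \o h))); rewrite fineK// ge0_fin_numE// Lnorm_ge0.
have ck0 : 0 < c * k0 / 2 by rewrite !mulr_gt0.
have := Lbound (Num.truncn (y / (c * k0 / 2))).+1; rewrite yE lee_fin.
move=> /(le_trans (tb _)); rewrite leNgt => /negP; apply.
rewrite mulrC -ltr_pdivrMr//; apply: lt_le_trans (truncnS_gt _) _.
by rewrite -natrX ler_nat ltnW// ltn_expl.
Qed.

End sobolev_bound.

(** * Finitely many orbits *)

Section finite_cover.
Variables (R : realType) (X : ptopologicalType).
Local Notation G := (PSL2 R).
Variables (act : G -> X -> X) (mu : {measure set (Borel X) -> \bar R}).
Hypothesis actP : is_Gspace act.
Hypothesis hX : hausdorff_space X.
Hypothesis mu1 : mu [set: Borel X] = 1%E.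

Lemma finite_orbit_cover (V K : set G) (e : R) :
  compact K -> V `<=` K -> 0 < e ->
  (forall U : set X, open U -> U !=set0 -> (e%:E <= mu (saturate act V U))%E) ->
  exists (L : set G) (s : seq X), compact L /\
    forall x, exists2 y, y \in s & exists2 g, L g & x = act g y.
Proof.
move=> cK VK e0 eU.
(* [K x] and [K y] meet exactly when [x] lies in [K^-1 K y]. If no finite list of points gave a
   cover, each new point could be chosen with [K x] disjoint from the earlier translates. *)
pose L := [set psl_mul g h | g in @psl_inv R @` K & h in K].
have cL : compact L by apply: compact_psl_mul => //; exact: compact_psl_inv.
apply: contrapT => nL.
have /choice[nx nxP] : forall s : seq X, exists x, forall y g, y \in s -> L g ->
    x <> act g y.
  move=> s; apply: contrapT => ns; apply: nL; exists L, s; split => // x.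
  apply: contrapT => nx; apply: ns; exists x => y g ys Lg xE; apply: nx.
  by exists y => //; exists g.
pose lst := fix lst n := if n is n'.+1 then nx (lst n') :: lst n' else [::].
pose pt n := nx (lst n).
have ptl i n : (i < n)%N -> pt i \in lst n.
  elim: n => // n IH; rewrite ltnS leq_eqVlt => /orP[/eqP ->|/IH h] /=.
    by rewrite inE eqxx.
  by rewrite inE h orbT.
have pt_lt i j k k' : (i < j)%N -> K k -> K k' -> act k (pt i) <> act k' (pt j).
  move=> ij Kk Kk' kk'; apply: (nxP (lst j) (pt i) (psl_mul (psl_inv k') k)).
  - exact: ptl.
  - by exists (psl_inv k'); [exists k'|exists k].
  - by rewrite (actM actP) kk' (actK actP).
have pt_neq i j k k' : i != j -> K k -> K k' -> act k (pt i) <> act k' (pt j).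
  rewrite neq_ltn => /orP[ij|ji] Kk Kk'; first exact: pt_lt.
  by move=> /esym; exact: pt_lt.
(* More than [1 / e] points, so that disjoint sets of measure at least [e] around their translates
   exceed total mass 1. *)
pose N := (Num.truncn e^-1).+1.
have eN : 1 < N%:R * e.
  by rewrite -ltr_pdivrMr// div1r truncnS_gt.
have /choice[AB ABP] : forall ij : 'I_N * 'I_N, exists AB : set X * set X,
    [/\ nbhs (pt ij.1) AB.1, nbhs (pt ij.2) AB.2 & ij.1 != ij.2 ->
      forall a b, AB.1 a -> AB.2 b ->
      forall g h, K g -> K h -> act g a <> act h b].
  move=> [i j] /=; have [ij|ij] := eqVneq i j.
    by exists (setT, setT); split => //; exact: filterT.
  have [[A B] /= [nA nB] ABn] := near_disjoint_orbits actP hX cK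
    (fun g h Kg Kh => pt_neq i j g h ij Kg Kh).
  exists (A, B); split => // _ a b Aa Bb g h Kg Kh.
  exact: (ABn (a, b) (conj Aa Bb) g h Kg Kh).
(* A point occurs as first and as second member of pairs, so its neighbourhood is intersected over
   both roles. *)
pose O' (i : 'I_N) : set X := [set a | forall j, (AB (i, j)).1 a /\ (AB (j, i)).2 a].
have nO (i : 'I_N) : nbhs (pt i) (O' i).
  apply: filter_forall => j; apply: filterI.
    by have [] := ABP (i, j).
  by have [] := ABP (j, i).
pose F i := saturate act V (O' i)^°.
have oF i : open (F i) by apply: open_saturate => //; exact: open_interior.
have mF i : measurable (F i : set (Borel X)) by exact: borel_open.
have tF : trivIset [set: 'I_N] F.
  apply/trivIsetP => i j _ _ ij; apply/seteqP; split => // x [].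
  move=> [g Vg [a /interior_subset Oa gx]] [h Vh [b /interior_subset Ob hx]].
  have [_ _ /(_ ij a b)] := ABP (i, j).
  move=> /(_ (Oa j).1 (Ob i).2 g h (VK _ Vg) (VK _ Vh)); apply.
  by rewrite gx hx.
have : ((N%:R * e)%:E <= mu (\big[setU/set0]_(i < N) F i : set (Borel X)))%E.
  rewrite (measure_bigsetU_ord _ xpredT mF tF) EFinM mule_natl.
  have -> : (e%:E *+ N = \sum_(i < N) e%:E)%E by rewrite sumr_const card_ord.
  apply: lee_sum => i _; apply: eU; first exact: open_interior.
  by exists (pt i); exact: nO.
apply/negP; rewrite -ltNge; apply: (@le_lt_trans _ _ 1%E); last first.
  by rewrite lte_fin.
rewrite -mu1; apply: le_measure; rewrite ?inE//.
exact: bigsetU_measurable.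
Qed.

End finite_cover.

(** * Fixed points as closed conditions *)

Section fixed_points.
Variables (R : realType) (X : topologicalType).
Local Notation G := (PSL2 R).
Variable act : G -> X -> X.
Hypothesis actP : is_Gspace act.
Hypothesis hX : hausdorff_space X.

Lemma closed_fix g : closed [set x | act g x = x].
Proof.
rewrite -[X in closed X]setCK; apply: open_closedC; rewrite openE => x /= gx.
apply: (@cvg_neq _ hX _ (nbhs x) _ (act g) id (act g x) x) => //.
exact: act_continuous.
Qed.

Hypothesis cX : compact [set: X].

(** The limit argument in contrapositive form: compactness of [X] makes the neighbourhood of [g]
    uniform in [x], so an element approximated by elements with fixed points has a fixed point
    itself. *)
Lemma near_no_fix g : (forall x, act g x <> x) ->
  \forall h \near g, forall x, act h x <> x.
Proof.
move=> ng; have /compact_near_coveringP cov := cX.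
have nf : \forall h \near g, [set: X] `<=` (fun x => act h x <> x).
  apply: (cov G (nbhs g) (fun h x => act h x <> x) _) => x _.
  apply: (@cvg_neq _ hX _ (filter_prod (nbhs x) (nbhs g)) _
     (fun p => act p.2 p.1) fst (act g x) x _ _ (ng x)).
    by apply: cvg_act; [|exact: cvg_snd|exact: cvg_fst].
  exact: cvg_fst.
by apply: filterS nf => h Hh x; exact: Hh.
Qed.

End fixed_points.

(** * Non-discrete stabilizers *)

Section unipotent_fixed_point.
Variables (R : realType) (X : topologicalType).
Local Notation G := (PSL2 R).
Variable act : G -> X -> X.
Hypothesis actP : is_Gspace act.
Hypothesis hX : hausdorff_space X.
Hypothesis cX : compact [set: X].

Definition stab (x : X) : set G := [set g | act g x = x].

(** Non-discreteness is given at some [a] of the stabilizer; multiplying nearby elements by the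
    inverse of [a] moves it to the identity. Of the two lifts to matrices, one close to the identity
    matrix is kept. *)
Lemma nondiscrete_stab (x : X) (e : R) : ~ is_discrete (stab x) -> 0 < e ->
  exists M : 'M[R]_2, [/\ \det M = 1, M <> 1%:M, stab x (psl_of M) &
    forall i j, `|M i j - (1%:M : 'M[R]_2) i j| < e].
Proof.
move=> nd e0.
have /existsNP[a /not_implyP[ax nU]] := nd.
pose W := [set psl_of M | M in [set M : 'M[R]_2 | \det M = 1 /\
  forall i j, `|M i j - (1%:M : 'M[R]_2) i j| < e]].
have nW : nbhs (psl_one R) W.
  apply/nbhs_psl; first exact: det1.
  have := @nbhsx_ballx _ _ (1%:M : 'M[R]_2) e e0.
  apply: filterS => N [_ bN] dN; exists N => //; split => // i j.
  by rewrite distrC; exact: bN.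
have nU' := nbhs_psl_translate a nW.
have [b [Ub bx ba]] : exists b, [/\ W (psl_mul (psl_inv a) b), stab x b & b <> a].
  apply: contrapT => nb; apply: nU.
  exists [set h | W (psl_mul (psl_inv a) h)]^°; split.
  - exact: open_interior.
  - exact: nU'.
  - apply/seteqP; split => [b [/interior_subset Wb bx]|_ ->] /=; last by split.
    by apply: contrapT => ba; apply: nb; exists b.
case: Ub => M [dM eM] ME; exists M; split => //.
- move=> M1; apply: ba; rewrite -[b](psl_mulKVg a) -ME M1.
  exact: psl_mulg1.
- by rewrite ME /stab /= (actM actP) bx -[X in act _ X]ax (actK actP).
Qed.

Lemma fix_uuN s x : act (uu s) x = x -> act (uu (- s)) x = x.
Proof. by move=> sx; rewrite uuN -{1}sx (actK actP). Qed.

Lemma conj_uu (t : R) (M : 'M[R]_2) : \det M = 1 ->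
  psl_mul (uu (- t)) (psl_mul (psl_of M) (uu t)) =
  psl_of (mx2 (M 0 0 - t * M 1 0)
    (M 0 1 + t * (M 0 0 - M 1 1) - t ^+ 2 * M 1 0)
    (M 1 0) (M 1 1 + t * M 1 0)).
Proof.
move=> dM; rewrite psl_mul3E ?det_uu// {1}(mx2_eta M) !mx2M.
by congr psl_of; congr mx2; ring.
Qed.

Lemma conj_dd (l a b c d : R) : l != 0 -> \det (mx2 a b c d) = 1 ->
  psl_mul (dd l) (psl_mul (psl_of (mx2 a b c d)) (dd l^-1)) =
  psl_of (mx2 a (l ^+ 2 * b) (c / l ^+ 2) d).
Proof.
move=> l0 dM; rewrite psl_mul3E ?det_dd ?invr_eq0// !mx2M.
by congr psl_of; congr mx2; field.
Qed.

Lemma stab_conj g h x : stab x h ->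
  stab (act g x) (psl_mul g (psl_mul h (psl_inv g))).
Proof. by move=> hx; rewrite /stab /= !(actM actP) (actK actP) hx. Qed.

Lemma dd_inv (l : R) : l != 0 -> dd l^-1 = psl_inv (dd l).
Proof.
move=> l0; have ddV : psl_mul (dd l) (dd l^-1) = psl_one R.
  rewrite psl_mulE ?det_dd ?invr_eq0// mx2M -dd1 /dd invr1.
  by congr psl_of; congr mx2; field.
by rewrite -[LHS](psl_mulKg (dd l)) ddV psl_mulg1.
Qed.

Lemma upper_entries_eq0 (p q r u : R) : p * u - q * r = 1 -> 0 < p ->
  q = 0 -> q + (p - u) - r = 0 -> q - (p - u) - r = 0 -> [/\ p = 1, r = 0 & u = 1].
Proof.
move=> det1 p0 q0 h1 h2.
have r0 : r = 0 by lra.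
have up : u = p by lra.
move/eqP: det1; rewrite up q0 mul0r subr0 -expr2 sqrf_eq1.
by move=> /orP[/eqP p1|/eqP pN1]; [|lra].
Qed.

(** The expression is the upper right entry after conjugation by [uu t], a quadratic polynomial in
    [t]. Were it 0 at [0], [1] and [-1], all its coefficients would vanish, so [M] would be plus or
    minus the identity; [0 < M 0 0] rules out the minus sign. *)
Lemma conj_upper_neq0 (M : 'M[R]_2) : \det M = 1 -> M <> 1%:M -> 0 < M 0 0 ->
  exists2 t : R, `|t| <= 1 & M 0 1 + t * (M 0 0 - M 1 1) - t ^+ 2 * M 1 0 != 0.
Proof.
move=> dM M1 p0; apply: contrapT => nt; apply: M1.
have q t : `|t| <= 1 -> M 0 1 + t * (M 0 0 - M 1 1) - t ^+ 2 * M 1 0 = 0.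
  by move=> t1; apply/eqP; apply: contrapT => /negP q0; apply: nt; exists t.
have := q 0; rewrite normr0 expr0n /= !mul0r subr0 addr0 => /(_ ler01) q0.
have := q 1; rewrite normr1 expr1n !mul1r => /(_ (lexx _)) q1.
have := q (-1); rewrite normrN1 sqrrN expr1n mul1r mulN1r => /(_ (lexx _)) q2.
have dE : M 0 0 * M 1 1 - M 0 1 * M 1 0 = 1 by rewrite -det_mx2 -mx2_eta.
have [p1 r0 u1] := upper_entries_eq0 dE p0 q0 q1 q2.
by rewrite (mx2_eta M) q0 p1 r0 u1 -mx2_1.
Qed.

Lemma conj_entries_near (p q r u t e : R) : `|p - 1| < e -> `|q| < e ->
  `|r| < e -> `|u - 1| < e -> `|t| <= 1 ->
  [/\ `|p - t * r - 1| < 2 * e, `|q + t * (p - u) - t ^+ 2 * r| <= 4 * e &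
    `|u + t * r - 1| < 2 * e].
Proof.
move=> hp hq hr hu ht.
have e2 : 2 * e = e + e by ring.
have htr : `|t * r| < e by rewrite normrM (le_lt_trans _ hr)// ler_piMl.
have hpu : `|t * (p - u)| <= 2 * e.
  rewrite normrM (le_trans (ler_piMl _ ht))//.
  rewrite (_ : p - u = p - 1 - (u - 1)); last by ring.
  by rewrite (le_trans (ler_normB _ _))// e2 lerD// ltW.
have httr : `|t ^+ 2 * r| <= e.
  by rewrite normrM normrX (le_trans (ler_piMl _ _))// ?exprn_ile1// ltW.
split.
- rewrite (_ : _ - 1 = p - 1 - t * r); last by ring.
  by rewrite (le_lt_trans (ler_normB _ _))// e2 ltrD.
- rewrite (_ : 4 * e = e + 2 * e + e); last by ring.
  rewrite (le_trans (ler_normB _ _))// lerD//.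
  by rewrite (le_trans (ler_normD _ _))// lerD// ltW.
- rewrite (_ : _ - 1 = u - 1 + t * r); last by ring.
  by rewrite (le_lt_trans (ler_normD _ _))// e2 ltrD.
Qed.

(* Conjugating an element of the stabilizer close to the identity by a suitable
   diagonal matrix scales its upper right entry to [s] or [- s], while the other
   entries stay close to those of the identity. *)
Lemma uu_fixed_point (x : X) (s : R) : ~ is_discrete (stab x) -> 0 < s ->
  exists z, act (uu s) z = z.
Proof.
move=> nd s0; apply: contrapT => nz.
have n1 y : act (uu s) y <> y by move=> yE; apply: nz; exists y.
have n2 y : act (uu (- s)) y <> y.
  by move=> /fix_uuN; rewrite opprK; exact: n1.
have ball_no_fix t : (forall y, act (uu t) y <> y) -> exists2 e : R, 0 < e &
    forall N : 'M[R]_2, \det N = 1 -> (forall i j, `|mx2 1 t 0 1 i j - N i j| < e) ->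
    forall y, act (psl_of N) y <> y.
  move=> nt; have := near_no_fix actP hX cX nt.
  move=> /(nbhs_psl _ (det_uu t))/nbhs_ballP[e /= e0 eN]; exists e => // N dN Ne.
  by apply: eN => //; split.
have [e1 e10 e1P] := ball_no_fix _ n1; have [e2 e20 e2P] := ball_no_fix _ n2.
(* The bound 1 makes [M 0 0] positive. With [s / 4], the new upper right entry [b] satisfies
   [|b| <= 4 e <= s], so the rescaling cannot enlarge the lower left entry. The other two bounds
   keep the result inside the balls free of fixed points. *)
pose e := Num.min (Num.min 1 (s / 4)) (Num.min (e1 / 4) (e2 / 4)).
have e0 : 0 < e by rewrite !lt_min ltr01 !divr_gt0.
have : e <= e by [].
rewrite {2}/e !le_min => /andP[/andP[e_le1 es] /andP[ee1 ee2]].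
have [M [dM M1 Mx Me]] := nondiscrete_stab nd e0.
have := Me 0 0; have := Me 0 1; have := Me 1 0; have := Me 1 1.
rewrite !mxE /= !subr0 => hu hr hq hp.
have p0 : 0 < M 0 0.
  move: hp; rewrite ltr_norml => /andP[hp _].
  have : -1 < M 0 0 - 1 by apply: le_lt_trans hp; rewrite lerN2.
  by rewrite ltrBrDl subrr.
have [t t1 b0] := conj_upper_neq0 dM M1 p0.
have [ha hb hd] := conj_entries_near hp hq hr hu t1.
move: (conj_uu t dM) ha hb hd b0.
set a := M 0 0 - _; set b := M 0 1 + _ - _; set d := M 1 1 + _; set c := M 1 0.
move=> MtE ha hb hd b_neq0.
have nb0 : 0 < `|b| by rewrite normr_gt0.
(* Conjugation by [dd l] multiplies the upper right entry by [l ^ 2], turning [b] into [s] or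
   [- s]. *)
pose l := Num.sqrt (s / `|b|).
have l0 : 0 < l by rewrite sqrtr_gt0 divr_gt0.
have l2 : l ^+ 2 = s / `|b| by rewrite sqr_sqrtr// ltW// divr_gt0.
have dN : \det (mx2 a b c d) = 1.
  have dE : M 0 0 * M 1 1 - M 0 1 * M 1 0 = 1 by rewrite -det_mx2 -mx2_eta.
  rewrite det_mx2 -[RHS]dE /a /b /d /c.
  by move: (M 0 0) (M 0 1) (M 1 0) (M 1 1) => p q r u; ring.
pose N := mx2 a (l ^+ 2 * b) (c / l ^+ 2) d.
have dN' : \det N = 1.
  rewrite /N det_mx2 -[RHS]dN det_mx2; congr (_ - _).
  by rewrite mulrC mulrA divfK ?expf_neq0 ?lt0r_neq0// mulrC.
have [z zN] : exists z, act (psl_of N) z = z.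
  exists (act (dd l) (act (uu (- t)) x)).
  rewrite /N -(conj_dd (lt0r_neq0 l0) dN) dd_inv ?lt0r_neq0//.
  have tE : uu t = psl_inv (uu (- t)) by rewrite -uuN opprK.
  apply: stab_conj; rewrite -MtE tE.
  exact: stab_conj.
have cl : `|c / l ^+ 2| < e.
  rewrite l2 invf_div normrM [`|_ / s|]normrM normr_id normfV (gtr0_norm s0).
  apply: le_lt_trans hr; rewrite ler_piMr// ler_pdivrMr// mul1r.
  by rewrite (le_trans hb)// mulrC -ler_pdivlMr.
have close e' t' : e <= e' / 4 -> l ^+ 2 * b = t' ->
    forall i j, `|mx2 1 t' 0 1 i j - N i j| < e'.
  rewrite ler_pdivlMr// => ee' bt.
  have e_lt : e < e' by apply: lt_le_trans ee'; rewrite ltr_pMr// ltr1n.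
  have e2_lt : 2 * e < e'.
    by apply: lt_le_trans ee'; rewrite mulrC ltr_pM2l// ltr_nat.
  move=> i j; rewrite !mxE; case: (i == 0); case: (j == 0).
  - by rewrite distrC (lt_trans ha).
  - by rewrite bt subrr normr0 (lt_trans e0).
  - by rewrite sub0r normrN (lt_trans cl).
  - by rewrite distrC (lt_trans hd).
have [b_gt0|b_le0] := ltP 0 b.
  apply: (e1P N dN' (close _ _ ee1 _) z zN).
  by rewrite l2 gtr0_norm// divfK// gt_eqF.
apply: (e2P N dN' (close _ _ ee2 _) z zN).
by rewrite l2 ler0_norm// invrN mulrN mulNr divfK.
Qed.

End unipotent_fixed_point.

(** * A common fixed point of the upper unipotents *)

Section common_fixed_point.
Variables (R : realType) (X : topologicalType).
Local Notation G := (PSL2 R).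
Variable act : G -> X -> X.
Hypothesis actP : is_Gspace act.
Hypothesis hX : hausdorff_space X.
Hypothesis cX : compact [set: X].

Definition ufix : set X := [set z | forall s, act (uu s) z = z].

Lemma uu_fix_muln s z n : act (uu s) z = z -> act (uu (n%:R * s)) z = z.
Proof.
move=> sz; elim: n => [|n IH]; first by rewrite mul0r uu0 (act1 actP).
by rewrite -natr1 mulrDl mul1r uuD (actM actP) sz.
Qed.

(** Each [s] may have its own fixed point; dyadic steps make them compatible. A fixed point of
    [uu (2^-m)] is fixed by [uu (2^-n)] for [n <= m], so a cluster point is fixed by every
    [uu (2^-n)], hence by all dyadic parameters and, by density, by all real ones. *)
Lemma ufix_exists : (forall s, 0 < s -> exists z, act (uu s) z = z) ->
  ufix !=set0.
Proof.
move=> fixs.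
have h0 n : 0 < (2 ^+ n)^-1 :> R by rewrite invr_gt0 exprn_gt0.
have /choice[z zP] : forall n, exists z, act (uu (2 ^+ n)^-1) z = z.
  by move=> n; exact: fixs.
have [//|y [_ yF]] := cX (F := z @ \oo); first exact: filterT.
have yfix n : act (uu (2 ^+ n)^-1) y = y.
  have := @closed_fix _ _ _ actP hX (uu (2 ^+ n)^-1) y; apply => B nB.
  apply: yF => //; exists n => // m /= nm.
  have -> : (2 ^+ n)^-1 = (2 ^ (m - n))%:R * (2 ^+ m)^-1 :> R.
    rewrite natrX -{2}(subnK nm) exprD invfM mulrA mulfV ?mul1r//.
  exact: uu_fix_muln.
have ypos s : 0 <= s -> act (uu s) y = y.
  move=> s0; apply: contrapT => sy.
  have /nbhs_ballP[e /= e0 eP] : \forall t \near s, act (uu t) y <> y.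
    apply: (@cvg_neq _ hX _ (nbhs s) _ (fun t => act (uu t) y) (fun=> y)
        (act (uu s) y) y) => //; last exact: (cvg_cst y).
    apply: cvg_act => //; [exact: uu_continuous|exact: (cvg_cst y)].
  pose n := Num.truncn e^-1; pose k := Num.truncn (s * 2 ^+ n).
  apply: (eP (k%:R * (2 ^+ n)^-1)); last exact: uu_fix_muln.
  have sk : 0 <= s * 2 ^+ n by rewrite mulr_ge0// exprn_ge0.
  have k1 : k%:R <= s * 2 ^+ n by rewrite truncn_le.
  have k2 : s * 2 ^+ n < k.+1%:R by rewrite truncnS_gt.
  rewrite /ball /= ger0_norm ?subr_ge0 ?ler_pdivrMr ?exprn_gt0//.
  apply: (@lt_le_trans _ _ ((2 ^+ n)^-1)).
    rewrite ltrBlDr -{1}[s](mulfK (_ : 2 ^+ n != 0)) ?expf_neq0 ?pnatr_eq0//.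
    by rewrite -{2}[_^-1]mul1r -mulrDl ltr_pM2r// nat1r.
  rewrite -[leRHS]invrK lef_pV2 ?posrE ?exprn_gt0 ?invr_gt0//.
  apply: le_trans (ltW (truncnS_gt _)) _.
  by rewrite -natrX ler_nat ltn_expl.
exists y => s; have [s0|s0] := leP 0 s; first exact: ypos.
by rewrite -[s]opprK; apply: fix_uuN => //; apply: ypos; rewrite oppr_ge0 ltW.
Qed.

Lemma ufix_dd l z : l != 0 -> ufix z -> ufix (act (dd l) z).
Proof. by move=> l0 zf s; rewrite -(actM actP) dd_uu// (actM actP) zf. Qed.

End common_fixed_point.

(** * Poincare recurrence, and positive measure of pieces of an orbit *)

Section recurrence.
Variables (R : realType) (X : ptopologicalType).
Local Notation G := (PSL2 R).
Variables (act : G -> X -> X) (mu : {measure set (Borel X) -> \bar R}).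
Hypothesis actP : is_Gspace act.
Hypothesis hX : hausdorff_space X.
Hypothesis mu1 : mu [set: Borel X] = 1%E.
Hypothesis mu_inv : forall (g : G) (A : set (Borel X)), measurable A ->
  mu (act g @^-1` A) = mu A.

(** One return of one point, at a positive time, is enough here. Without it the preimages of [D]
    under the iterates would be infinitely many disjoint sets of the same positive measure. *)
Lemma poincare_recurrence (g : G) (D : set (Borel X)) : measurable D ->
  (0 < mu D)%E -> exists n x, D x /\ D (iter n.+1 (act g) x).
Proof.
move=> mD D0; apply: contrapT => nrec.
pose F n : set (Borel X) := iter n (act g) @^-1` D.
have FS n : F n.+1 = act g @^-1` F n.
  by apply/seteqP; split => x; rewrite /F /preimage /= -iterSr.
have mF n : measurable (F n).
  elim: n => // n IH; rewrite FS -[_ @^-1` _]setTI.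
  exact: (borel_continuous (act_continuous actP (g := g))).
have muF n : mu (F n) = mu D by elim: n => // n IH; rewrite FS mu_inv.
have tF : trivIset [set: nat] F.
  suff lt i j : (i < j)%N -> F i `&` F j = set0.
    apply/trivIsetP => i j _ _; rewrite neq_ltn => /orP[/lt//|/lt].
    by rewrite setIC.
  move=> ij; apply/seteqP; split => // x [Fi Fj]; apply: nrec.
  exists (j - i).-1, (iter i (act g) x); split => //.
  by rewrite prednK ?subn_gt0// -iterD subnK// ltnW.
have Dfin : mu D \is a fin_num.
  by rewrite ge0_fin_numE// (le_lt_trans (mu_le1 mu1 mD))// ltry.
have [d d0 dE] : exists2 d : R, 0 < d & mu D = d%:E.
  by exists (fine (mu D)); [rewrite fine_gt0// D0 ltey_eq Dfin|rewrite fineK].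
pose N := (Num.truncn d^-1).+1.
have H : mu (\big[setU/set0]_(i < N) F i) = (\sum_(i < N) mu (F i))%E.
  apply: (measure_bigsetU_ord mu xpredT (fun i : 'I_N => mF i)); apply/trivIsetP => i j _ _ ij.
  by move/trivIsetP : tF => /(_ i j Logic.I Logic.I); apply.
have : (mu (\big[setU/set0]_(i < N) F i) <= 1)%E.
  by apply: mu_le1 => //; exact: bigsetU_measurable.
rewrite H; under eq_bigr do rewrite muF dE.
have -> : (\sum_(i < N) d%:E = (N%:R * d)%:E)%E.
  by rewrite sumr_const card_ord EFinM mule_natl.
rewrite lee_fin leNgt => /negP; apply.
by rewrite -ltr_pdivrMr// div1r truncnS_gt.
Qed.

(** Countably many translates of [C x] cover the single orbit, and they all have the same
    measure. *)
Lemma mu_orbit_gt0 (C : set G) (g : G) (x : X) : compact C -> nbhs g C ->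
  (forall y, exists h, y = act h x) -> (0 < mu (act^~ x @` C))%E.
Proof.
move=> cC nC tr.
have cD := compact_orbit actP (x := x) cC.
have mD : measurable (act^~ x @` C : set (Borel X)).
  by apply: borel_closed; exact: compact_closed.
rewrite lt0e measure_ge0 andbT; apply/negP => /eqP D0.
have nV : nbhs (psl_one R) (psl_mul g @^-1` C).
  by apply: psl_mull_continuous; rewrite psl_mulg1.
have [gi giP] := psl_countable_cover nV.
pose F i : set (Borel X) :=
  act (psl_mul (gi i) (psl_inv g)) @` (act^~ x @` C).
have mF i : measurable (F i) by exact: measurable_act.
have TF : [set: Borel X] `<=` \bigcup_i F i.
  move=> y _; have [h ->] := tr y; have [i Ci] := giP h; exists i => //.
  exists (act (psl_mul g (psl_mul (psl_inv (gi i)) h)) x).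
    by exists (psl_mul g (psl_mul (psl_inv (gi i)) h)).
  by rewrite -(actM actP) -psl_mulA psl_mulKg psl_mulKVg.
have := measure_sigma_subadditive mu mF measurableT TF.
rewrite eseries0; last by move=> i _ _; rewrite mu_act.
by rewrite mu1 lee_fin ler10.
Qed.

End recurrence.

(** * From one point fixed by the upper unipotents to a trivial action *)

Section nondiscrete.
Variables (R : realType) (X : ptopologicalType).
Local Notation G := (PSL2 R).
Variables (act : G -> X -> X) (mu : {measure set (Borel X) -> \bar R}).
Hypothesis actP : is_Gspace act.
Hypothesis hX : hausdorff_space X.
Hypothesis cX : compact [set: X].
Hypothesis mu1 : mu [set: Borel X] = 1%E.
Hypothesis mu_inv : forall (g : G) (A : set (Borel X)), measurable A ->
  mu (act g @^-1` A) = mu A.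

Lemma iter_dd l n x : l != 0 -> iter n (act (dd l)) x = act (dd (l ^+ n)) x.
Proof.
move=> l0; elim: n => [|n IH]; first by rewrite expr0 dd1 (act1 actP).
by rewrite iterS IH -(actM actP) !ddX.
Qed.

Hypothesis tr : forall x y, exists g, y = act g x.

(* If [act g z] were not fixed, a compact neighbourhood of [g] would give a set
   of positive measure avoiding the fixed points; but recurrence under [dd l],
   which contracts the lower unipotent part, brings points of that set
   arbitrarily close to fixed points. *)
Lemma ufix_big_cell (z : X) (M : 'M[R]_2) : ufix act z -> \det M = 1 ->
  M 0 0 != 0 -> ufix act (act (psl_of M) z).
Proof.
move=> zf dM M0 s; apply: contrapT => sM.
pose S := `|M 1 0 / M 0 0| + 1.
have S0 : 0 < S by rewrite ltr_wpDl.
(* On [Q] the lower unipotent coordinate of the big cell is bounded by [S], uniformly over the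
   compact neighbourhood chosen below. *)
pose Q := [set psl_of N | N in [set N : 'M[R]_2 |
  [/\ \det N = 1, N 0 0 != 0 & `|N 1 0 / N 0 0| < S]]].
have nQ : nbhs (psl_of M) Q.
  apply/nbhs_psl => //.
  have c00 := @cvg_coord R M 0 0; have c10 := @cvg_coord R M 1 0.
  have h10 := cvg_norm (cvgM c10 (cvgV M0 c00)).
  have lt1 : `|M 1 0 / M 0 0| < S by rewrite ltrDl.
  have n10 : nbhs M [set N : 'M[R]_2 | `|N 1 0 / N 0 0| < S] .
    exact: (h10 _ _ _ _ (lt_nbhsl lt1)).
  have n00 : nbhs M [set N : 'M[R]_2 | N 0 0 != 0].
    have := c00 _ (open_nbhs_nbhs (conj (@open_neq R 0) M0)).
    exact.
  by apply: filterS2 n10 n00 => N h1 h2 dN; exists N.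
have nO : \forall h \near psl_of M, act (uu s) (act h z) <> act h z.
  apply: (@cvg_neq _ hX _ (nbhs (psl_of M)) _ (fun h => act (uu s) (act h z))
      (fun h => act h z) (act (uu s) (act (psl_of M) z)) (act (psl_of M) z)) => //.
    apply: cvg_act => //; first exact: (cvg_cst (uu s)).
    exact: act_orbit_continuous.
  exact: act_orbit_continuous.
have [C [cC nC CQ]] := psl_compact_nbhs (filterI nO nQ).
pose D := act^~ z @` C.
have cD : compact D by exact: compact_orbit.
have mD : measurable (D : set (Borel X)).
  by apply: borel_closed; exact: compact_closed.
have D0 : (0 < mu D)%E by apply: (mu_orbit_gt0 actP hX mu1 mu_inv cC nC).
(* By compactness of [D], the points of [D] stay unfixed by [uu s] after any sufficiently small
   lower unipotent displacement. *)
have near0 : \forall r \near (0 : R), D `<=`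
    (fun y => act (uu s) (act (ll (- r)) y) <> act (ll (- r)) y).
  have /compact_near_coveringP cov := cD.
  apply: (cov R (nbhs (0 : R))
    (fun r y => act (uu s) (act (ll (- r)) y) <> act (ll (- r)) y) _) => y Dy.
  have lly : act (ll (- 0)) y = y by rewrite oppr0 ll0 (act1 actP).
  have llc : (fun p : X * R => act (ll (- p.2)) p.1) @
      filter_prod (nbhs y) (nbhs (0 : R)) --> y.
    rewrite -[X in _ --> X]lly; apply: cvg_act => //; last exact: cvg_fst.
    have lc : ll (- r) @[r --> nbhs (0 : R)] --> ll (- 0 : R).
      by apply: (cvg_comp _ _ (cvgN (@cvg_id _ (nbhs (0 : R))))); exact: ll_continuous.
    exact: (cvg_comp _ _ (@cvg_snd _ _ (nbhs y) (nbhs (0:R)) _) lc).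
  have [g Cg gy] := Dy.
  apply: (@cvg_neq _ hX _ (filter_prod (nbhs y) (nbhs (0 : R))) _ _ _
     (act (uu s) y) y _ llc).
    by apply: cvg_act => //; exact: (cvg_cst (uu s)).
  by rewrite -gy; case: (CQ _ Cg).
have [e /= e0 eP] : exists2 e : R, 0 < e & forall r, `|r| < e -> D `<=`
    (fun y => act (uu s) (act (ll (- r)) y) <> act (ll (- r)) y).
  have /nbhs_ballP[e /= e0 eP] := near0; exists e => // r re.
  by apply: eP; rewrite /ball /= sub0r normrN.
(* With this choice [S <= e * l], so already one step of [dd l] contracts coordinates below [S] to
   less than [e]; further steps only help. *)
pose l := 1 + S / e.
have l1 : 1 < l by rewrite ltrDl divr_gt0.
have l_gt0 : 0 < l by rewrite (lt_trans _ l1).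
have l_neq0 : l != 0 by rewrite gt_eqF.
have [n [y [Dy]]] := poincare_recurrence actP mu1 mu_inv (dd l) mD D0.
rewrite iter_dd//; set L := l ^+ n.+1 => DL.
have lL : l <= L by rewrite /L ler_eXnr// ltW.
have L0 : 0 < L by rewrite (lt_le_trans _ lL)// (lt_trans _ l1).
have [g Cg gy] := Dy; have [_ [N [dN N0 NS] Ng]] := CQ _ Cg.
pose r := N 1 0 / N 0 0 / L ^+ 2.
pose w := act (dd L) (act (dd (N 0 0)) z).
have wf : ufix act w by do 2 ?apply: ufix_dd => //; rewrite gt_eqF.
(* Moving [dd L] past the lower unipotent factor divides its parameter by [L ^ 2], and the diagonal
   factors keep [z] fixed by the upper unipotents. The returning point is thus a small displacement
   of the fixed point [w]. *)
have yE : act (dd L) y = act (ll r) w.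
  rewrite -gy -Ng big_cell// -!(actM actP) psl_mulA dd_ll ?gt_eqF//.
  by rewrite /w !(actM actP) zf.
have re : `|r| < e.
  rewrite /r normrM normfV (@gtr0_norm _ (L ^+ 2)) ?exprn_gt0//.
  rewrite ltr_pdivrMr ?exprn_gt0//; apply: (lt_le_trans NS).
  have Se : S <= e * l by rewrite mulrDr mulr1 mulrCA mulfV ?gt_eqF// mulr1 lerDr ltW.
  apply: le_trans Se _; rewrite ler_pM2l// (le_trans lL)// expr2 ler_peMl ?(ltW L0)//.
  by rewrite (le_trans _ lL)// ltW.
apply: (eP r re (act (dd L) y) DL).
by rewrite yE llN (actK actP) wf.
Qed.

(** Outside the big cell, [M 1 0] is nonzero and left multiplication by [uu (-1)] leads into the
    cell. The image there is fixed by the upper unipotents, so undoing this multiplication does not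
    move it. *)
Lemma ufixT (z : X) : ufix act z -> forall x, ufix act x.
Proof.
move=> zf x; have [g ->] := tr z x; case: (psl_ofP g) => M dM ->.
have [M0|] := eqVneq (M 0 0) 0; last exact: ufix_big_cell.
pose N := mx2 1 (-1) 0 1 *m M.
have dN : \det N = 1 by rewrite det_mulmx2 ?det_uu.
have -> : psl_of M = psl_mul (uu 1) (psl_of N).
  by rewrite -[psl_of N]psl_mulE ?det_uu// psl_mulA -uuD subrr uu0 psl_mul1g.
have c0 : M 1 0 != 0.
  apply/eqP => c0; have : M 0 0 * M 1 1 - M 0 1 * M 1 0 = 1.
    by rewrite -det_mx2 -mx2_eta.
  by rewrite M0 c0 mul0r mulr0 subrr => /esym/eqP; rewrite oner_eq0.
have N0 : N 0 0 != 0.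
  by rewrite /N {1}(mx2_eta M) mx2M mxE /= M0 mulr0 add0r mulN1r oppr_eq0.
have nf := ufix_big_cell zf dN N0.
by rewrite (actM actP) nf.
Qed.

Lemma ll_conj (t : R) : ll t =
  psl_mul (psl_of (mx2 0 1 (-1) 0))
    (psl_mul (uu (- t)) (psl_inv (psl_of (mx2 0 1 (-1) 0)))).
Proof.
have dw : \det (mx2 0 1 (-1) 0) = 1 :> R by rewrite det_mx2; ring.
rewrite psl_invE// invmx2E// psl_mul3E ?det_uu//; last first.
  by rewrite det_mx2 !mxE /=; ring.
by rewrite !mx2M !mxE /=; congr psl_of; congr mx2; ring.
Qed.

Lemma trivial_of_nondiscrete_stab (x0 : X) :
  ~ is_discrete (stab act x0) -> forall x, x = x0.
Proof.
move=> nd.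
have [z zf] : ufix act !=set0.
  by apply: ufix_exists => // s s0; exact: (uu_fixed_point actP hX cX nd s0).
have uT x s : act (uu s) x = x by exact: (ufixT zf x).
have lT x s : act (ll s) x = x by rewrite ll_conj !(actM actP) uT (actKV actP).
move=> x; have [g ->] := tr x0 x; have [s [t [r [v ->]]]] := ulul g.
by rewrite !(actM actP) !(uT, lT).
Qed.

End nondiscrete.

(** * The coset space *)

Section homogeneous.
Variables (R : realType) (X : ptopologicalType).
Local Notation G := (PSL2 R).
Variable act : G -> X -> X.
Hypothesis actP : is_Gspace act.
Hypothesis hX : hausdorff_space X.

Lemma stab_subgroup (x : X) : is_subgroup (stab act x).
Proof.
split; first exact: (act1 actP).
  by move=> a b ax bx; rewrite /stab /= (actM actP) bx ax.
by move=> a ax; rewrite /stab /= -{1}ax (actK actP).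
Qed.

Lemma coset_of_continuous (Gam : set G) :
  continuous (coset_of Gam : G -> QG Gam).
Proof. by apply/continuousP => U; exact. Qed.

Variable x0 : X.
Local Notation Gam := (stab act x0).

(** The orbit map on right cosets [Gam g] has to be [g^-1 x0]: stabilizing elements on the left of
    [g] become elements acting directly on [x0], and the formula intertwines [qact] with [act]. *)
Lemma coset_of_eqP (g h : G) :
  coset_of Gam g = coset_of Gam h <-> act (psl_inv g) x0 = act (psl_inv h) x0.
Proof.
split => [[e]|e].
  have : rcoset Gam h g.
    by rewrite -e; exists (psl_one R); [exact: (act1 actP)|exact: psl_mul1g].
  move=> [a ax <-]; rewrite psl_invM (actM actP); congr act.
  by rewrite -{1}ax (actK actP).
apply: eq_exist; apply/seteqP; split => _ [a ax <-].
  exists (psl_mul a (psl_mul g (psl_inv h))).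
    by rewrite /stab /= !(actM actP) -e (actKV actP).
  by rewrite -!psl_mulA psl_mulVg psl_mulg1.
exists (psl_mul a (psl_mul h (psl_inv g))).
  by rewrite /stab /= !(actM actP) e (actKV actP).
by rewrite -!psl_mulA psl_mulVg psl_mulg1.
Qed.

Lemma coset_repK (y : QG Gam) : coset_of Gam (coset_rep y) = y.
Proof.
rewrite /coset_rep; case: cid => g /= e; case: y e => A hA /= e.
by apply: eq_exist.
Qed.

(** The inverses of elements of [K] represent all cosets, so the coset space is compact; the orbit
    map is then a continuous bijection from a compact space to a Hausdorff one, hence closed. *)
Lemma homogeneous_iso (K : set G) : compact K ->
  (forall x, exists2 g, K g & x = act g x0) -> is_discrete Gam ->
  cocompact_lattice Gam /\ Gspace_iso act (@qact R Gam).
Proof.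
move=> cK KX dG.
have cQ : compact [set: QG Gam].
  have -> : [set: QG Gam] = (coset_of Gam : G -> QG Gam) @` (@psl_inv R @` K).
    apply/seteqP; split => // y _.
    have [g Kg gx] := KX (act (psl_inv (coset_rep y)) x0).
    exists (psl_inv g); first by exists g.
    rewrite -[RHS]coset_repK; apply/coset_of_eqP.
    by rewrite psl_invK gx.
  apply: continuous_compact; last exact: compact_psl_inv.
  by apply: continuous_subspaceT; exact: coset_of_continuous.
split; first by split => //; exact: stab_subgroup.
have /choice[r rP] : forall x, exists g, x = act g x0.
  by move=> x; have [g _ ->] := KX x; exists g.
pose v (y : QG Gam) : X := act (psl_inv (coset_rep y)) x0.
pose u (x : X) : QG Gam := coset_of Gam (psl_inv (r x)).
have vE g : v (coset_of Gam g) = act (psl_inv g) x0.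
  by apply/coset_of_eqP; exact: coset_repK.
have uv : cancel u v by move=> x; rewrite vE psl_invK -rP.
have vu : cancel v u.
  move=> y; rewrite /u -[RHS]coset_repK; apply/coset_of_eqP.
  by rewrite psl_invK -rP.
have cv : continuous v.
  apply/continuousP => U oU.
  have oU' : open ((fun g : G => act (psl_inv g) x0) @^-1` U).
    apply: open_comp => // g _.
    apply: (@continuous_comp _ _ _ (@psl_inv R) (act^~ x0)).
      exact: psl_inv_continuous.
    exact: act_orbit_continuous.
  suff : open ((coset_of Gam : G -> QG Gam) @^-1` (v @^-1` U)) by [].
  rewrite (_ : _ @^-1` _ = (fun g : G => act (psl_inv g) x0) @^-1` U)//.
  by apply/seteqP; split => g; rewrite /preimage /= vE.
have cu : continuous u.
  apply/continuous_closedP => A cA.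
  have -> : u @^-1` A = v @` A.
    apply/seteqP; split => [x Ax|_ [y Ay <-]]; first by exists (u x).
    by rewrite /preimage /= vu.
  apply: compact_closed => //; apply: continuous_compact.
    exact: continuous_subspaceT.
  exact: (subclosed_compact cA cQ).
exists u, v; split => // g x.
rewrite /qact /u; apply/coset_of_eqP.
rewrite psl_invM psl_invK !psl_invK (actM actP) -rP.
have := uv x; rewrite /v => ->; by rewrite (rP (act g x)) -rP.
Qed.

End homogeneous.

Theorem theorem11p3 (R : realType) (X : ptopologicalType)
  (act : PSL2 R -> X -> X) (mu : {measure set (Borel X) -> \bar R}) :
  is_Gspace act ->
  hausdorff_space X ->
  connected [set: X] ->
  mu [set: Borel X] = 1%E ->
  (forall (g : PSL2 R) (A : set (Borel X)), measurable A ->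
     mu (act g @^-1` A) = mu A) ->
  (forall U : set X, open U -> U !=set0 -> (0 < mu U)%E) ->
  qualitative_Sobolev act mu ->
  (exists x0 : X, forall x : X, x = x0) \/
  (exists Gam : set (PSL2 R), cocompact_lattice Gam /\
     Gspace_iso act (@qact R Gam)).
Proof.
move=> actP hX conX mu1 mu_inv mu_supp sob.
have [V [K [e [cK VK e0 eU]]]] := sobolev_lower_bound actP mu1 mu_inv mu_supp sob.
have [L [s [cL sL]]] := finite_orbit_cover actP hX mu1 cK VK e0 eU.
pose x0 : X := point.
have [K' cK' K'X] := transitive_of_finite_cover actP hX x0 conX cL sL.
have cX : compact [set: X].
  have -> : [set: X] = act^~ x0 @` K'.
    by apply/seteqP; split => // x _; have [g Kg ->] := K'X x; exists g.
  exact: compact_orbit.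
have tr x y : exists g, y = act g x.
  have [g _ ->] := K'X y; have [h _ ->] := K'X x.
  by exists (psl_mul g (psl_inv h)); rewrite (actM actP) (actK actP).
have [dG|nG] := pselect (is_discrete (stab act x0)); last first.
  left; exists x0.
  exact: (trivial_of_nondiscrete_stab actP hX cX mu1 mu_inv tr nG).
by right; exists (stab act x0); exact: homogeneous_iso cK' K'X dG.
Qed.
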